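(* Consider second-order PDEs in 4D of the form $$u_{13}+u_{24}+f(x,u,Du)\,(u_{11}u_{22}-u_{12}^2)=0 .$$ The conformal structure $[g]$ represented by $$g=dx_1dx_3+dx_2dx_4-f u_{22}\,dx_3^2+2f u_{12}\,dx_3dx_4-f u_{11}\,dx_4^2$$ is half-flat on every solution if and only if $$f=c_0(x_1x_3+x_2x_4)+c_1x_1+c_2x_2+c_3x_3+c_4x_4+c_5,$$ where the constants $c_0,\dots,c_5$ satisfy the single quadratic constraint $c_1c_3+c_2c_4-c_0c_5=0$.
   Context: The setting is local. $u$ is a scalar function of $x=(x_1,\dots,x_4)$; $Du$ denotes the collection of first-order partial derivatives of $u$ and $u_{\alpha\beta}=\partial_{x_\alpha}\partial_{x_\beta}u$. The metric $g$ displayed represents the conformal structure defined by the characteristic variety $\sum_{\alpha\le\beta}\frac{\partial F}{\partial u_{\alpha\beta}}p_\alpha p_\beta=0$ of the equation $F=0$ (its matrix is, up to a conformal factor, inverse to the matrix of this quadratic form). Half-flatness: let $W$ be the Weyl tensor of $[g]$ and $W_\pm=\tfrac12(W\pm *W)$ with $*$ the Hodge star operator, $*W^i{}_{jkl}=\tfrac12\sqrt{\det g}\;g^{ia}g^{bc}\epsilon_{ajbd}W^d{}_{ckl}$. $[g]$ is half-flat on every solution if $W_-=0$ on every solution or $W_+=0$ on every solution. *)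

(* Defs.v *)
From HB Require Import structures.
From mathcomp Require Import all_boot all_order all_algebra.
From mathcomp Require Import all_classical all_reals all_analysis.

Set Implicit Arguments.
Unset Strict Implicit.
Unset Printing Implicit Defensive.

Import Order.TTheory GRing.Theory Num.Theory.
Import numFieldNormedType.Exports.

Local Open Scope classical_set_scope.
Local Open Scope ring_scope.

(* ['D_v1 ('D_v2 (... f))] for [vs = [:: v1; v2; ...]] *)
Definition iter_derive {R : realType} {V : normedModType R} (vs : seq V)
    (f : V -> R) : V -> R :=
  foldr (fun (v : V) (h : V -> R) => 'D_v h) f vs.

(* C^oo on the open set [U]: f and all its iterated directional derivatives
   are Frechet differentiable at every point of [U] (here [V] is always
   finite-dimensional).  Functions are total, but if [U] is open this only
   depends on the values of [f] on [U]. *)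
Definition smooth_on {R : realType} {V : normedModType R} (U : set V)
    (f : V -> R) : Prop :=
  forall (vs : seq V) (x : V), U x -> differentiable (iter_derive vs f) x.

(* The coordinates x_1, x_2, x_3, x_4 have the indices [i1], [i2], [i3], [i4]. *)
Definition i1 : 'I_4 := @Ordinal 4 0 isT.
Definition i2 : 'I_4 := @Ordinal 4 1 isT.
Definition i3 : 'I_4 := @Ordinal 4 2 isT.
Definition i4 : 'I_4 := @Ordinal 4 3 isT.

Definition partial {R : realType} (i : 'I_4) (h : 'rV[R]_4 -> R) :
    'rV[R]_4 -> R :=
  'D_(delta_mx ord0 i : 'rV[R]_4) h.

Definition partial2 {R : realType} (i j : 'I_4) (h : 'rV[R]_4 -> R) :
    'rV[R]_4 -> R :=
  partial i (partial j h).

Section Curvature.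
Context {R : realType}.

Definition tensor4 := 'I_4 -> 'I_4 -> 'I_4 -> 'I_4 -> R.

Variable g : 'rV[R]_4 -> 'M[R]_4.

Definition ginv (x : 'rV[R]_4) : 'M[R]_4 := invmx (g x).

(* [christoffel i j k] is Gamma^i_{jk} *)
Definition christoffel (i j k : 'I_4) (x : 'rV[R]_4) : R :=
  2^-1 * \sum_(l < 4) ginv x i l *
    (partial j (fun y => g y l k) x + partial k (fun y => g y l j) x
     - partial l (fun y => g y j k) x).

(* [riemann x i j k l] is R^i_{jkl}, with the convention
   R(d_k, d_l) d_j = R^i_{jkl} d_i *)
Definition riemann (x : 'rV[R]_4) : tensor4 := fun i j k l =>
  partial k (christoffel i l j) x - partial l (christoffel i k j) x
  + \sum_(m < 4) (christoffel i k m x * christoffel m l j x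
                  - christoffel i l m x * christoffel m k j x).

Definition ricci (x : 'rV[R]_4) (j l : 'I_4) : R :=
  \sum_(i < 4) riemann x i j i l.

Definition ricci_up (x : 'rV[R]_4) (i j : 'I_4) : R :=
  \sum_(m < 4) ginv x i m * ricci x m j.

Definition scalar_curvature (x : 'rV[R]_4) : R := \sum_(i < 4) ricci_up x i i.

Definition kron (i j : 'I_4) : R := (i == j)%:R.

(* [weyl x i j k l] is W^i_{jkl}; 1/2 and 1/6 are 1/(n-2) and 1/((n-1)(n-2))
   for n = 4 *)
Definition weyl (x : 'rV[R]_4) : tensor4 := fun i j k l =>
  riemann x i j k l
  - 2^-1 * (kron i k * ricci x j l - kron i l * ricci x j k
            + g x j l * ricci_up x i k - g x j k * ricci_up x i l)
  + 6^-1 * scalar_curvature x * (kron i k * g x j l - kron i l * g x j k).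

(* Levi-Civita symbol, normalised by epsilon_{1234} = 1 *)
Definition levi_civita (a b c d : 'I_4) : R :=
  (sgz (b%:Z - a%:Z) * sgz (c%:Z - a%:Z) * sgz (d%:Z - a%:Z) *
   sgz (c%:Z - b%:Z) * sgz (d%:Z - b%:Z) * sgz (d%:Z - c%:Z))%:~R.

Definition hodge (x : 'rV[R]_4) (W : tensor4) : tensor4 := fun i j k l =>
  2^-1 * Num.sqrt (\det (g x)) *
    \sum_(a < 4) \sum_(b < 4) \sum_(c < 4) \sum_(d < 4)
      ginv x i a * ginv x b c * levi_civita a j b d * W d c k l.

Definition weyl_plus (x : 'rV[R]_4) : tensor4 := fun i j k l =>
  2^-1 * (weyl x i j k l + hodge x (weyl x) i j k l).

Definition weyl_minus (x : 'rV[R]_4) : tensor4 := fun i j k l =>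
  2^-1 * (weyl x i j k l - hodge x (weyl x) i j k l).

End Curvature.

(* First-order jets (x, u, Du) of scalar functions on R^4 *)
Notation jet1 R := ('rV[R]_4 * R * 'rV[R]_4)%type.

Section Equation.
Context {R : realType}.

Definition jet (u : 'rV[R]_4 -> R) (x : 'rV[R]_4) : jet1 R :=
  (x, u x, \row_(i < 4) partial i u x).

Variable f : jet1 R -> R.

Definition pde_lhs (u : 'rV[R]_4 -> R) (x : 'rV[R]_4) : R :=
  partial2 i1 i3 u x + partial2 i2 i4 u x
  + f (jet u x) * (partial2 i1 i1 u x * partial2 i2 i2 u x
                   - partial2 i1 i2 u x ^+ 2).

(* [D] is the domain of [f]; [u] is a smooth local solution on [U]. *)
Definition solution (D : set (jet1 R)) (U : set 'rV[R]_4)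
    (u : 'rV[R]_4 -> R) : Prop :=
  [/\ open U, smooth_on U u &
      forall x, U x -> D (jet u x) /\ pde_lhs u x = 0].

(* Symmetric matrix of
   dx1 dx3 + dx2 dx4 - f u22 dx3^2 + 2 f u12 dx3 dx4 - f u11 dx4^2;
   the off-diagonal entries are half the coefficients of dx_i dx_j. *)
Definition metric (u : 'rV[R]_4 -> R) (x : 'rV[R]_4) : 'M[R]_4 :=
  \matrix_(i < 4, j < 4)
    if ((i, j) == (i1, i3)) || ((i, j) == (i3, i1)) then 2^-1
    else if ((i, j) == (i2, i4)) || ((i, j) == (i4, i2)) then 2^-1
    else if (i, j) == (i3, i3) then - (f (jet u x) * partial2 i2 i2 u x)
    else if ((i, j) == (i3, i4)) || ((i, j) == (i4, i3))
      then f (jet u x) * partial2 i1 i2 u x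
    else if (i, j) == (i4, i4) then - (f (jet u x) * partial2 i1 i1 u x)
    else 0.

(* The same one of the two halves of the Weyl tensor is required to vanish on
   all solutions. *)
Definition half_flat_on_every_solution (D : set (jet1 R)) : Prop :=
  (forall U u, solution D U u -> forall x, U x ->
     forall i j k l, weyl_minus (metric u) x i j k l = 0) \/
  (forall U u, solution D U u -> forall x, U x ->
     forall i j k l, weyl_plus (metric u) x i j k l = 0).

End Equation.

(* Main.v *)
(* The metric g is a Walker metric: with A = f u_22, B = f u_12, C = f u_11 it is
   dx1 dx3 + dx2 dx4 - A dx3^2 + 2 B dx3 dx4 - C dx4^2.  One half of its Weyl
   tensor contains fourth derivatives of u in x1 alone, and its vanishing along
   the solution u = (x1 - a)^4 forces f = 0.  The rest concerns the other half.

   Necessity: polynomials u that are quadratic in x1, x2 with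
   u_13 + u_24 = u_11 u_22 - u_12^2 = 0 solve the equation for every f.  On them
   the half Weyl tensor reduces to second derivatives of f along the jet of u.
   Varying the third, then the second derivatives of u kills the derivatives of
   f with respect to Du and u, and what remains is a set of linear conditions on
   the Hessian of f in x that determine the quadratic form.  For such f the half
   Weyl tensor of an arbitrary solution reduces, modulo the equation and its
   first two derivatives, to multiples of
   (f f_13 - f_1 f_3 - f_2 f_4) (u_11 u_22 - u_12^2), and
   f f_13 - f_1 f_3 - f_2 f_4 = c0 c5 - c1 c3 - c2 c4.
   This gives sufficiency, and an explicit rational solution with
   u_11 u_22 - u_12^2 <> 0 gives the necessity of the constraint. *)

Require Import Defs.
From HB Require Import structures.
From mathcomp Require Import all_boot all_order all_algebra.
From mathcomp Require Import all_classical all_reals all_analysis.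
From mathcomp Require Import ring lra ssrZ zify.
From Stdlib Require BinInt.

Set Implicit Arguments.
Unset Strict Implicit.
Unset Printing Implicit Defensive.

Import Order.TTheory GRing.Theory Num.Theory.
Import numFieldNormedType.Exports.

Local Open Scope classical_set_scope.
Local Open Scope ring_scope.

(** * Smooth functions *)

(** The curvature of [metric f u] involves [u] up to order four and has 256 components, so it is not
    expanded in the real field. The metric is encoded by differential polynomials with integer
    coefficients in a few unknown functions; curvature, Hodge dual and reduction modulo the equation
    are computed on these lists, and [ev_pderive] transfers the outcome to actual derivatives. This
    transfer rests on the symmetry of second derivatives, [derive_comm].

    All solutions used are explicit. The equation sees [u] and [Du] only through [f]; a polynomial
    that solves it for every [f] therefore remains a solution when an affine function is added, and
    its 1-jet at a point can be prescribed while its second derivatives stay fixed. This is how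
    identities at an arbitrary point of [D] are reached. Once [f] is known to depend on x alone, the
    rational solution has the same freedom. *)

Section SmoothCalculus.
Context {R : realType} {V : normedModType R}.
Implicit Types (U : set V) (f g : V -> R) (v w x y : V).

(** The difference [g - f] vanishes near [x], so the zero map satisfies the little-o
    characterisation of its differential, and [g] is [f] plus a differentiable function. *)
Lemma near_eq_differentiable f g x :
  (\near x, f x = g x) -> differentiable f x -> differentiable g x.
Proof.
move=> fg df.
have -> : g = f + (g - f) by rewrite addrC subrK.
apply: differentiableD => //.
have E : (g - f) \o shift x = cst ((g - f) x) + (\0 : V -> R) +o_ 0 id.
  apply/eqaddoP => e e0.
  have h0 : (g - f) x = 0 by rewrite !fctE (nbhs_singleton fg) subrr.
  rewrite h0; near=> y.
  have -> : ((g - f) \o shift x - (cst 0 + \0)) y = 0.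
    rewrite !fctE /= addr0 subr0 -(_ : f (y + x) = g (y + x)) ?subrr //.
    near: y; move: fg; rewrite (near_shift 0) subr0; exact.
  by rewrite normr0 mulr_ge0 // ltW.
have c0 : continuous (\0 : V -> R) by move=> y; apply: cvg_cst.
apply/diff_locallyP; split; first by rewrite (diff_unique c0 E).
by rewrite (diff_unique c0 E) {1}E.
Unshelve. all: by end_near. Qed.

Lemma open_eq_near U f g x :
  open U -> U x -> (forall y, U y -> f y = g y) -> \near x, f x = g x.
Proof. by move=> oU Ux fg; near=> y; apply: fg; near: y; apply: open_nbhs_nbhs. 
Unshelve. all: by end_near. Qed.

Lemma derive_eq_on U f g v :
  open U -> (forall x, U x -> f x = g x) ->
  forall x, U x -> 'D_v f x = 'D_v g x.
Proof. by move=> oU fg x Ux; apply/near_eq_derive/(open_eq_near oU Ux fg). Qed.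

(** Bounding the number of derivatives turns closure under products and inverses into an induction:
    the derivative of a product still contains the factors themselves, but asks one order less of
    them. *)
Definition smooth_upto (n : nat) U f : Prop :=
  forall vs : seq V, (size vs <= n)%N ->
    forall x, U x -> differentiable (iter_derive vs f) x.

Lemma smooth_uptoP U f : smooth_on U f <-> forall n, smooth_upto n U f.
Proof.
split=> [h n vs _ x|h vs x]; first exact: h.
exact: (h (size vs)).
Qed.

Lemma iter_derive_rcons vs v f :
  iter_derive (rcons vs v) f = iter_derive vs ('D_v f).
Proof. by rewrite /iter_derive foldr_rcons. Qed.

(** Directions are peeled off at the innermost end, where the product and quotient rules apply. *)
Lemma smooth_uptoS n U f :
  smooth_upto n.+1 U f <->
  (forall x, U x -> differentiable f x) /\ forall v, smooth_upto n U ('D_v f).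
Proof.
split=> [h|[h0 h] vs].
  split=> [x|v vs svs x Ux]; first exact: (h [::]).
  by rewrite -iter_derive_rcons; apply: h; rewrite // size_rcons.
case/lastP: vs => [_|vs v]; first exact: h0.
by rewrite size_rcons iter_derive_rcons; apply: h.
Qed.

Lemma smooth_upto0 U f :
  smooth_upto 0 U f <-> (forall x, U x -> differentiable f x).
Proof.
split=> [h x|h vs]; first exact: (h [::]).
by rewrite leqn0 => /nilP ->.
Qed.

Lemma smooth_uptoW n U f : smooth_upto n.+1 U f -> smooth_upto n U f.
Proof. by move=> h vs svs; apply: h; apply: leqW. Qed.

Lemma smooth_upto_eq n U f g : open U -> (forall x, U x -> f x = g x) ->
  smooth_upto n U f -> smooth_upto n U g.
Proof.
move=> oU; have dE (h k : V -> R) : (forall x, U x -> h x = k x) ->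
    (forall x, U x -> differentiable h x) -> forall x, U x -> differentiable k x.
  by move=> hk dh x Ux; apply/near_eq_differentiable/(dh _ Ux)/(open_eq_near oU Ux hk).
elim: n f g => [|n IH] f g fg.
  by move=> /smooth_upto0 df; apply/smooth_upto0; apply: dE df.
move=> /smooth_uptoS[df sf]; apply/smooth_uptoS; split; first exact: dE df.
by move=> v; apply: IH (sf v); apply: derive_eq_on.
Qed.

Lemma smooth_on_eq U f g : open U -> (forall x, U x -> f x = g x) ->
  smooth_on U f -> smooth_on U g.
Proof.
by move=> oU fg /smooth_uptoP sf; apply/smooth_uptoP => n; apply: smooth_upto_eq (sf n).
Qed.

Lemma smooth_on_diff U f : smooth_on U f -> forall x, U x -> differentiable f x.
Proof. by move=> h x; apply: (h [::]). Qed.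

Lemma smooth_on_derivable U f v :
  smooth_on U f -> forall x, U x -> derivable f x v.
Proof. by move=> h x Ux; apply/diff_derivable/(smooth_on_diff h). Qed.

Lemma smooth_on_derive U f v : smooth_on U f -> smooth_on U ('D_v f).
Proof. by move=> h vs x; rewrite -iter_derive_rcons; apply: h. Qed.

Lemma smooth_on_sub U U' f : U' `<=` U -> smooth_on U f -> smooth_on U' f.
Proof. by move=> UU' h vs x /UU'; apply: h. Qed.

Lemma smooth_upto_cst n U (c : R) : smooth_upto n U (cst c).
Proof.
elim: n c => [|n IH] c; first by apply/smooth_upto0 => x _; apply: differentiable_cst.
apply/smooth_uptoS; split=> [x _|v]; first exact: differentiable_cst.
by rewrite (_ : 'D_v _ = cst 0) //; apply/funext => x; apply: derive_cst.
Qed.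

Lemma smooth_uptoD n U f g : open U ->
  smooth_upto n U f -> smooth_upto n U g -> smooth_upto n U (fun x => f x + g x).
Proof.
move=> oU; elim: n f g => [|n IH] f g.
  move=> /smooth_upto0 df /smooth_upto0 dg; apply/smooth_upto0 => x Ux.
  by apply: differentiableD; [apply: df|apply: dg].
move=> /smooth_uptoS[df sf] /smooth_uptoS[dg sg]; apply/smooth_uptoS.
split=> [x Ux|v]; first by apply: differentiableD; [apply: df|apply: dg].
apply: (smooth_upto_eq oU _ (IH _ _ (sf v) (sg v))) => x Ux.
by rewrite [RHS]deriveD //; apply: diff_derivable; [apply: df|apply: dg].
Qed.

Lemma smooth_uptoM n U f g : open U ->
  smooth_upto n U f -> smooth_upto n U g -> smooth_upto n U (fun x => f x * g x).
Proof.
move=> oU; elim: n f g => [|n IH] f g.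
  move=> /smooth_upto0 df /smooth_upto0 dg; apply/smooth_upto0 => x Ux.
  by apply: differentiableM; [apply: df|apply: dg].
move=> sf' sg'.
have /smooth_uptoS[df sf] := sf'; have /smooth_uptoS[dg sg] := sg'.
apply/smooth_uptoS.
split=> [x Ux|v]; first by apply: differentiableM; [apply: df|apply: dg].
apply: (smooth_upto_eq oU _ (smooth_uptoD oU
  (IH _ _ (smooth_uptoW sf') (sg v)) (IH _ _ (smooth_uptoW sg') (sf v)))) => x Ux.
by rewrite [RHS]deriveM //; apply: diff_derivable; [apply: df|apply: dg].
Qed.

Lemma smooth_uptoV n U f : open U -> (forall x, U x -> f x != 0) ->
  smooth_upto n U f -> smooth_upto n U (fun x => (f x)^-1).
Proof.
move=> oU f0; elim: n => [|n IH].
  move=> /smooth_upto0 df; apply/smooth_upto0 => x Ux.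
  by apply: differentiableV; [apply: df|apply: f0].
move=> sf'; have /smooth_uptoS[df sf] := sf'.
apply/smooth_uptoS.
split=> [x Ux|v]; first by apply: differentiableV; [apply: df|apply: f0].
have sV := IH (smooth_uptoW sf').
have sV2 := smooth_uptoM oU (smooth_uptoM oU sV sV)
  (smooth_uptoM oU (@smooth_upto_cst n U (-1)) (sf v)).
apply: (smooth_upto_eq oU _ sV2) => x Ux.
rewrite [RHS]deriveV //; [|exact: f0|by apply: diff_derivable; apply: df].
by rewrite /cst mulN1r mulrN -mulNr expr2 invfM.
Qed.

Lemma smooth_on_cst U (c : R) : smooth_on U (cst c).
Proof. by apply/smooth_uptoP => n; apply: smooth_upto_cst. Qed.

Lemma smooth_onD U f g : open U ->
  smooth_on U f -> smooth_on U g -> smooth_on U (fun x => f x + g x).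
Proof.
move=> oU /smooth_uptoP sf /smooth_uptoP sg; apply/smooth_uptoP => n.
exact: smooth_uptoD.
Qed.

Lemma smooth_onM U f g : open U ->
  smooth_on U f -> smooth_on U g -> smooth_on U (fun x => f x * g x).
Proof.
move=> oU /smooth_uptoP sf /smooth_uptoP sg; apply/smooth_uptoP => n.
exact: smooth_uptoM.
Qed.

Lemma smooth_onV U f : open U -> (forall x, U x -> f x != 0) ->
  smooth_on U f -> smooth_on U (fun x => (f x)^-1).
Proof.
move=> oU f0 /smooth_uptoP sf; apply/smooth_uptoP => n; exact: smooth_uptoV.
Qed.

Lemma derive_affine (g : V -> R) (z v : V) (a : R) :
  (forall h : R, g (h *: v + z) = g z + h * a) -> 'D_v g z = a.
Proof.
move=> gE; rewrite /derive; apply: cvg_lim => //.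
have E : {near 0^', (fun h : R => a) =1
   (fun h : R => h^-1 *: ((g \o shift z) (h *: v) - g z))}.
  near=> h; rewrite /= gE addrAC subrr add0r [RHS]mulKf //.
  by near: h; apply: nbhs_dnbhs_neq.
apply: cvg_trans (near_eq_cvg E) _; exact: cvg_cst.
Unshelve. all: by end_near. Qed.

Lemma is_derive_line f y v (s : R) :
  derivable f (y + s *: v) v ->
  is_derive s 1 (fun t : R => f (y + t *: v)) ('D_v f (y + s *: v)).
Proof.
have E : (fun h : R => h^-1 *: (((fun t : R => f (y + t *: v)) \o shift s)
           (h *: 1) - f (y + s *: v)))
       = (fun h : R => h^-1 *: ((f \o shift (y + s *: v)) (h *: v)
           - f (y + s *: v))).
  apply/funext => h; rewrite /= [h%:A](mulr1) scalerDl.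
  by rewrite addrCA.
move=> df; apply: DeriveDef; first by rewrite /derivable E.
by rewrite /derive E.
Qed.

Lemma MVT_line f y v (h : R) : 0 < h ->
  (forall s : R, 0 <= s <= h -> derivable f (y + s *: v) v) ->
  exists2 c, 0 < c < h & f (y + h *: v) - f y = h * 'D_v f (y + c *: v).
Proof.
move=> h0 df.
have dg (s : R) : 0 <= s <= h -> is_derive s 1 (fun t : R => f (y + t *: v))
    ('D_v f (y + s *: v)) by move=> /df; apply: is_derive_line.
have dgI s : s \in `]0, h[%R ->
    is_derive s 1 (fun t : R => f (y + t *: v)) ('D_v f (y + s *: v)).
  by rewrite in_itv /= => /andP[s0 sh]; apply: dg; rewrite !ltW.
have [|c cI] := MVT h0 dgI.
  apply: derivable_within_continuous => s; rewrite in_itv /= => sI.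
  by have [] := dg s sI.
by rewrite scale0r addr0 subr0 mulrC => E; exists c; move: cI; rewrite ?in_itv.
Qed.

Lemma near_cube U x v w : open U -> U x ->
  exists2 h : R, 0 < h &
    forall s t : R, 0 <= s <= h -> 0 <= t <= h -> U (x + s *: v + t *: w).
Proof.
move=> oU Ux; have /nbhs_ballP[r /= r0 rU] := open_nbhs_nbhs (conj oU Ux).
have n0 : 0 < `|v| + `|w| + 1 by rewrite ltr_wpDl ?addr_ge0 ?normr_ge0.
(* The summand 1 keeps the divisor positive when [v] and [w] are both zero, and makes the final
   inequality strict. *)
exists (r / (`|v| + `|w| + 1)); first by rewrite divr_gt0.
move=> s t /andP[s0 sh] /andP[t0 th]; apply: rU.
rewrite -ball_normE /= -addrA opprD addrA subrr sub0r normrN.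
apply: (le_lt_trans (ler_normD _ _)); rewrite !normrZ !ger0_norm //.
apply: (@le_lt_trans _ _ (r / (`|v| + `|w| + 1) * (`|v| + `|w|))).
  by rewrite mulrDr lerD // ler_wpM2r.
by rewrite mulrAC ltr_pdivrMr // ltr_pM2l // ltrDl.
Qed.

(** The mean value theorem is used twice: along [v] for the increment [y |-> f (y + h *: w) - f y],
    then along [w] for ['D_v f]. *)
Lemma second_difference U f x v w (h : R) : smooth_on U f -> 0 < h ->
  (forall s t : R, 0 <= s <= h -> 0 <= t <= h -> U (x + s *: v + t *: w)) ->
  exists s t, [/\ 0 <= s <= h, 0 <= t <= h &
    (f (x + h *: v + h *: w) - f (x + h *: v)) - (f (x + h *: w) - f x)
    = h ^+ 2 * 'D_w ('D_v f) (x + s *: v + t *: w)].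
Proof.
move=> sf h0 hU.
have hh : 0 <= h <= h by rewrite lexx (ltW h0).
have h00 : 0 <= (0 : R) <= h by rewrite lexx (ltW h0).
pose g y := f (y + h *: w) - f y.
have Uv (s : R) : 0 <= s <= h -> U (x + s *: v).
  by move=> /hU/(_ h00); rewrite scale0r addr0.
have Es s : (fun k : R => k^-1 *: (((fun y => f (y + h *: w)) \o shift (x + s *: v))
      (k *: v) - f (x + s *: v + h *: w)))
    = (fun k : R => k^-1 *: ((f \o shift (x + s *: v + h *: w)) (k *: v)
      - f (x + s *: v + h *: w))).
  by apply/funext => k /=; rewrite -!addrA.
have dg1 (s : R) : 0 <= s <= h -> derivable (fun y => f (y + h *: w)) (x + s *: v) v.
  move=> sI; rewrite /derivable Es.
  exact: (smooth_on_derivable sf (hU _ _ sI hh)).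
have Dg1 s : 'D_v (fun y => f (y + h *: w)) (x + s *: v)
      = 'D_v f (x + s *: v + h *: w).
  by rewrite /derive Es.
have dg (s : R) : 0 <= s <= h -> derivable g (x + s *: v) v.
  move=> sI; apply: derivableB; first exact: dg1.
  exact/(smooth_on_derivable sf)/Uv.
have [s /andP[s0 sh] E1] := MVT_line h0 dg.
have sI : 0 <= s <= h by rewrite !ltW.
have [t /andP[t0 th] E2] := @MVT_line ('D_v f) (x + s *: v) w h h0
   (fun t tI => smooth_on_derivable (smooth_on_derive v sf) (hU _ _ sI tI)).
have tI : 0 <= t <= h by rewrite !ltW.
exists s, t; split=> //; rewrite -/(g (x + h *: v)) -/(g x) E1.
rewrite expr2 -mulrA -E2; congr (_ * _).
rewrite [LHS]deriveB; [|exact: dg1|exact/(smooth_on_derivable sf)/Uv].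
by rewrite Dg1.
Qed.

(** Schwarz's theorem. The second difference over a small parallelogram is symmetric in [v] and [w],
    so the two mixed derivatives take a common value at points close to [x]; their continuity at [x]
    gives equality. *)
Lemma derive_comm U f v w x : open U -> smooth_on U f -> U x ->
  'D_v ('D_w f) x = 'D_w ('D_v f) x.
Proof.
move=> oU sf Ux; apply/eqP; rewrite -subr_eq0 -normr_le0.
apply/ler_addgt0Pl => e e0; rewrite addr0.
have cD v' w' : {for x, continuous ('D_v' ('D_w' f))}.
  by apply/differentiable_continuous/(smooth_on_diff _ Ux); do 2!apply: smooth_on_derive.
have e2 : 0 < e / 2 by rewrite divr_gt0.
have near2 v' w' : exists2 W, open W /\ W x & forall y, W y ->
    `|'D_v' ('D_w' f) x - 'D_v' ('D_w' f) y| < e / 2.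
  have /cvgrPdist_lt/(_ _ e2)/nbhs_ballP[r /= r0 rP] := cD v' w'.
  by exists (ball x r) => //; split; [exact: ball_open|exact: ballxx].
have [W1 [oW1 W1x] W1P] := near2 v w; have [W2 [oW2 W2x] W2P] := near2 w v.
pose W := U `&` (W1 `&` W2).
have oW : open W by do 2!apply: openI => //.
have Wx : W x by split.
have WU y : W y -> [/\ U y,
     `|'D_v ('D_w f) x - 'D_v ('D_w f) y| < e / 2 &
     `|'D_w ('D_v f) x - 'D_w ('D_v f) y| < e / 2].
  by move=> [Uy [/W1P h1 /W2P h2]]; split.
have [h h0 hW] := near_cube v w oW Wx.
have hU (s t : R) : 0 <= s <= h -> 0 <= t <= h -> U (x + s *: v + t *: w).
  by move=> sI tI; have [] := WU _ (hW _ _ sI tI).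
have hU' (s t : R) : 0 <= s <= h -> 0 <= t <= h -> U (x + s *: w + t *: v).
  by move=> sI tI; rewrite addrAC; apply: hU.
have [s [t [sI tI E]]] := second_difference sf h0 hU.
have [s' [t' [sI' tI' E']]] := second_difference sf h0 hU'.
have {}E : 'D_w ('D_v f) (x + s *: v + t *: w)
  = 'D_v ('D_w f) (x + s' *: w + t' *: v).
  apply: (@mulfI _ (h ^+ 2)); first by rewrite expf_neq0 // gt_eqF.
  apply: (etrans (esym E)); apply: (etrans _ E').
  rewrite [x + h *: w + h *: v]addrAC; ring.
have [_ _ B1] := WU _ (hW _ _ sI tI).
have := hW _ _ tI' sI'; rewrite addrAC => /WU [_ B2 _].
rewrite -E in B2; rewrite -(subrKA ('D_w ('D_v f) (x + s *: v + t *: w))).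
apply: (le_trans (ler_normD _ _)).
rewrite [e]splitr; apply: lerD; first exact: ltW B2.
by rewrite distrC; apply: ltW B1.
Qed.

(** On a ball inside [U] the mean value theorem along segments makes [f] constant, so a level set is
    both open and closed relative to [U]. *)
Lemma derive0_connected_cst U f : open U -> connected U ->
  (forall x, U x -> differentiable f x) ->
  (forall x v, U x -> 'D_v f x = 0) ->
  forall x y, U x -> U y -> f x = f y.
Proof.
move=> oU cU df Df x y Ux Uy.
have loc z : U z -> exists2 r : R, 0 < r & forall y, ball z r y -> U y /\ f y = f z.
  move=> Uz; have /nbhs_ballP[r /= r0 rU] := open_nbhs_nbhs (conj oU Uz).
  exists r => // y' By; split; first exact: rU.
  have seg (s : R) : 0 <= s <= 1 -> U (z + s *: (y' - z)).
    move=> /andP[s0 s1]; apply: rU; move: By; rewrite -ball_normE /=.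
    rewrite opprD addrA subrr sub0r normrN normrZ ger0_norm // distrC.
    by apply: le_lt_trans; rewrite ler_piMl.
  have [|c /andP[c0 c1]] := @MVT_line f z (y' - z) 1 ltr01.
    by move=> s /seg /df; apply: diff_derivable.
  rewrite scale1r [z + _]addrC subrK Df; last by apply: seg; rewrite !ltW.
  by rewrite mulr0 => /subr0_eq ->.
have : U `&` [set z | f z = f x] = U.
  apply: cU; first by exists x.
    exists (U `&` [set z | f z = f x]); last by rewrite setIA setIid.
    rewrite openE => z [Uz fz]; have [r r0 rP] := loc z Uz.
    apply/nbhs_ballP; exists r => //= y' /rP[Uy' fy'].
    by split=> //=; rewrite fy'.
  exists (~` (U `&` [set z | f z != f x])).
    apply: open_closedC; rewrite openE => z [Uz fz]; have [r r0 rP] := loc z Uz.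
    apply/nbhs_ballP; exists r => //= y' /rP[Uy' fy'].
    by split=> //=; rewrite fy'.
  apply/seteqP; split => z /= [Uz fz]; split=> //.
    by move=> [_]; rewrite fz eqxx.
  by apply/eqP/negPn/negP => fz'; apply: fz.
by move=> /seteqP[_ /(_ _ Uy)[_ ->]].
Qed.

End SmoothCalculus.

(** * Differential polynomials *)

Notation Z := BinNums.Z.
Notation zadd := BinInt.Z.add.
Notation zmul := BinInt.Z.mul.
Notation zeqb := BinInt.Z.eqb.
Notation znat := BinInt.Z.of_nat.
Notation z0 := BinNums.Z0.

(* An [atom] (k, [:: n1; n2; n3; n4]) denotes the partial derivative of
   multi-degree (n1, n2, n3, n4) of the [k]-th base function. *)
Definition atom := (nat * seq nat)%type.
(** Sums of integer multiples of monomials. [insert_atom] and [insert_term] sort both levels and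
    drop cancelled terms, so that an identity is checked by computing a difference down to
    [[::]]. *)
Definition dpoly := seq (Z * seq atom).

(** Multi-degrees are written without trailing zeros, a form preserved by [incr_nth]; a derivative
    reached in different orders is then always the same atom. *)
Definition incr (i : nat) (a : atom) : atom := (a.1, incr_nth a.2 i).

Fixpoint ltseq (s t : seq nat) : bool :=
  match s, t with
  | _, [::] => false
  | [::], _ => true
  | x :: s', y :: t' => (x < y)%N || ((x == y) && ltseq s' t')
  end.

Definition lta (a b : atom) : bool := ltseq (a.1 :: a.2) (b.1 :: b.2).

Fixpoint insert_atom (a : atom) (m : seq atom) : seq atom :=
  if m is b :: m' then if lta b a then b :: insert_atom a m' else a :: m
  else [:: a].

Fixpoint ltm (s t : seq atom) : bool :=
  match s, t with
  | _, [::] => false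
  | [::], _ => true
  | x :: s', y :: t' => lta x y || ((x == y) && ltm s' t')
  end.

Fixpoint insert_term (c : Z) (m : seq atom) (p : dpoly) : dpoly :=
  if p is (d, n) :: q then
    if m == n then
      let e := zadd c d in if zeqb e z0 then q else (e, m) :: q
    else if ltm m n then (c, m) :: p else (d, n) :: insert_term c m q
  else if zeqb c z0 then [::] else [:: (c, m)].

Definition padd (p q : dpoly) : dpoly :=
  foldr (fun t r => insert_term t.1 t.2 r) q p.

Definition pscale (c : Z) (p : dpoly) : dpoly :=
  map (fun t => (zmul c t.1, t.2)) p.

Definition psub (p q : dpoly) : dpoly := padd (pscale (BinNums.Zneg BinNums.xH) q) p.

Definition pmul (p q : dpoly) : dpoly :=
  foldr (fun t r => foldr (fun s r' =>
    insert_term (zmul t.1 s.1) (foldr insert_atom s.2 t.2) r') r q) [::] p.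

Fixpoint dmono (i : nat) (m : seq atom) : seq (seq atom) :=
  if m is a :: m' then
    insert_atom (incr i a) m' :: map (insert_atom a) (dmono i m')
  else [::].

Definition pderive (i : nat) (p : dpoly) : dpoly :=
  foldr (fun t r => padd (map (fun m => (t.1, m)) (dmono i t.2)) r) [::] p.

Definition psum4 (f : nat -> dpoly) : dpoly :=
  padd (f 0%N) (padd (f 1%N) (padd (f 2%N) (f 3%N))).

Definition patom (k : nat) (s : seq nat) : dpoly := [:: (znat 1, [:: (k, s)])].
Definition pconst (c : Z) : dpoly := if zeqb c z0 then [::] else [:: (c, [::])].

Section PartialCommute.
Context {R : realType}.
Local Notation V := 'rV[R]_4.
Implicit Types (U : set V) (f g : V -> R).

Lemma smooth_on_partial U f i : smooth_on U f -> smooth_on U (partial i f).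
Proof. exact: smooth_on_derive. Qed.

Lemma smooth_on_iter_partial U f i n :
  smooth_on U f -> smooth_on U (iter n (partial i) f).
Proof. by move=> sf; elim: n => //= n; apply: smooth_on_partial. Qed.

Lemma partial_eq_on U f g i : open U -> (forall x, U x -> f x = g x) ->
  forall x, U x -> partial i f x = partial i g x.
Proof. exact: derive_eq_on. Qed.

Lemma iter_partial_eq_on U f g i n : open U -> (forall x, U x -> f x = g x) ->
  forall x, U x -> iter n (partial i) f x = iter n (partial i) g x.
Proof. by move=> oU fg; elim: n => //= n; apply: partial_eq_on. Qed.

Lemma partial_comm U f i j : open U -> smooth_on U f ->
  forall x, U x -> partial i (partial j f) x = partial j (partial i f) x.
Proof. by move=> oU sf x Ux; apply: derive_comm sf Ux. Qed.

Lemma partial_iter_comm U f i j n : open U -> smooth_on U f ->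
  forall x, U x ->
    partial i (iter n (partial j) f) x = iter n (partial j) (partial i f) x.
Proof.
move=> oU sf; elim: n => //= n IH x Ux.
rewrite (partial_comm i j oU (smooth_on_iter_partial j n sf) Ux).
exact: (partial_eq_on j oU IH).
Qed.

Definition multi_partial (s : seq nat) f : V -> R :=
  iter (nth 0%N s 0) (partial i1) (iter (nth 0%N s 1) (partial i2)
    (iter (nth 0%N s 2) (partial i3) (iter (nth 0%N s 3) (partial i4) f))).

Lemma smooth_on_multi_partial U s f :
  smooth_on U f -> smooth_on U (multi_partial s f).
Proof. by move=> sf; do 4!apply: smooth_on_iter_partial. Qed.

Lemma ord4P (P : 'I_4 -> Prop) : P i1 -> P i2 -> P i3 -> P i4 -> forall i, P i.
Proof.
move=> p1 p2 p3 p4 [[|[|[|[|//]]]] H].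
- by rewrite (_ : Ordinal H = i1) //; apply: val_inj.
- by rewrite (_ : Ordinal H = i2) //; apply: val_inj.
- by rewrite (_ : Ordinal H = i3) //; apply: val_inj.
- by rewrite (_ : Ordinal H = i4) //; apply: val_inj.
Qed.

(** By Schwarz's theorem the new derivative passes the blocks of the earlier coordinates until it
    joins its own. *)
Lemma partial_multi_partial U (i : 'I_4) s f : open U -> smooth_on U f ->
  forall x, U x ->
    partial i (multi_partial s f) x = multi_partial (incr_nth s i) f x.
Proof.
move=> oU sf x Ux; rewrite /multi_partial.
have S j n (h : V -> R) := @smooth_on_iter_partial U h j n.
have E j n (h k : V -> R) := @iter_partial_eq_on U h k j n oU.
have C j n (h : V -> R) := @partial_iter_comm U h i j n oU.
elim/ord4P: i C => C; rewrite !nth_incr_nth /= ?add0n ?add1n //.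
- by rewrite C //; do 3!apply: (S).
- rewrite C //; last by do 3!apply: (S).
  by apply: (E) => // y Uy; rewrite C //; do 2!apply: (S).
- rewrite C //; last by do 3!apply: (S).
  apply: (E) => // y Uy; rewrite C //; last by do 2!apply: (S).
  by apply: (E) => // z Uz; rewrite C //; apply: (S).
Qed.

End PartialCommute.

Section Evaluation.
Context {R : realType}.
Local Notation V := 'rV[R]_4.
Variables (U : set V) (oU : open U) (bs : nat -> V -> R).
Hypothesis sbs : forall k, smooth_on U (bs k).

Definition zr (z : Z) : R := (int_of_Z z)%:~R.

Lemma zrD a b : zr (zadd a b) = zr a + zr b.
Proof. by rewrite /zr -rmorphD -(rmorphD int_of_Z). Qed.
Lemma zrM a b : zr (zmul a b) = zr a * zr b.
Proof. by rewrite /zr -rmorphM -(rmorphM int_of_Z). Qed.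
Lemma zr_eq0 a : zeqb a z0 -> zr a = 0.
Proof. by move=> /BinInt.Z.eqb_eq ->. Qed.

Lemma zr_nat n : zr (znat n) = n%:R :> R.
Proof.
by rewrite /zr (Z_of_intK (Posz n)) pmulrn.
Qed.

Lemma zr_neq0 (c : Z) : ~~ zeqb c z0 -> zr c != 0 :> R.
Proof. by rewrite /zr intr_eq0; case: c => //= p _; lia. Qed.

Definition atom_ev (a : atom) : V -> R := multi_partial a.2 (bs a.1).
Definition mono_ev (m : seq atom) (x : V) : R :=
  foldr (fun a r => atom_ev a x * r) 1 m.
Definition ev (p : dpoly) (x : V) : R :=
  foldr (fun t r => zr t.1 * mono_ev t.2 x + r) 0 p.

Lemma insert_atom_ev a m x : mono_ev (insert_atom a m) x = atom_ev a x * mono_ev m x.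
Proof. by elim: m => //= b m IH; case: ifP => //= _; rewrite IH mulrCA. Qed.

Lemma insert_term_ev c m p x :
  ev (insert_term c m p) x = zr c * mono_ev m x + ev p x.
Proof.
elim: p => [|[d n] p IH] /=.
  by case: ifP => //= /zr_eq0 ->; rewrite mul0r addr0.
case: eqP => [<-|_].
  rewrite addrA -mulrDl -zrD; case: ifP => //= /zr_eq0 ->.
  by rewrite mul0r add0r.
case: ifP => //= _; by rewrite IH addrCA.
Qed.

Lemma ev_nil x : ev [::] x = 0. Proof. by []. Qed.

Lemma ev_padd p q x : ev (padd p q) x = ev p x + ev q x.
Proof.
by elim: p => [|t p IH] /=; rewrite ?add0r // insert_term_ev IH addrA.
Qed.

Lemma ev_pscale c p x : ev (pscale c p) x = zr c * ev p x.
Proof. by elim: p => [|t p IH] /=; rewrite ?mulr0 // IH zrM mulrDr mulrA. Qed.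

Lemma ev_psub p q x : ev (psub p q) x = ev p x - ev q x.
Proof. by rewrite ev_padd ev_pscale /zr /= mulN1r addrC. Qed.

Lemma mono_ev_mul m n x :
  mono_ev (foldr insert_atom n m) x = mono_ev m x * mono_ev n x.
Proof.
by elim: m => [|a m IH] /=; rewrite ?mul1r // insert_atom_ev IH mulrA.
Qed.

Lemma ev_eq_of_psub p q x :
  psub p q = [::] -> ev p x = ev q x.
Proof. by move=> E; apply/eqP; rewrite -subr_eq0 -ev_psub E. Qed.

Lemma ev_pmul p q x : ev (pmul p q) x = ev p x * ev q x.
Proof.
elim: p => [|t p IH] /=; first by rewrite mul0r.
rewrite mulrDl -IH -/(pmul p q); move: (pmul p q) => r.
elim: q {IH} => [|s q IH] /=; first by rewrite mulr0 add0r.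
rewrite insert_term_ev IH mono_ev_mul zrM; ring.
Qed.

Lemma unscale0 c p q x : p = pscale c q ->
  ~~ zeqb c z0 -> ev p x = 0 -> ev q x = 0.
Proof.
move=> -> /zr_neq0 c0; rewrite ev_pscale => /eqP.
by rewrite mulf_eq0 (negPf c0) => /eqP.
Qed.

Lemma ev_psum4 (f : nat -> dpoly) x :
  ev (psum4 f) x = \sum_(i < 4) ev (f i) x.
Proof. by rewrite !ev_padd !big_ord_recl big_ord0 addr0. Qed.

Lemma ev_patom k s x : ev (patom k s) x = multi_partial s (bs k) x.
Proof. by rewrite /ev /= addr0 mul1r mulr1. Qed.

Lemma ev_pconst c x : ev (pconst c) x = zr c.
Proof.
rewrite /pconst; case: ifP => [/zr_eq0 ->//|_].
by rewrite /ev /= addr0 mulr1.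
Qed.

Lemma smooth_on_mono_ev m : smooth_on U (mono_ev m).
Proof.
elim: m => [|a m IH] /=; first exact: smooth_on_cst.
by apply: smooth_onM => //; apply: smooth_on_multi_partial.
Qed.

Lemma smooth_on_ev p : smooth_on U (ev p).
Proof.
elim: p => [|t p IH] /=; first exact: smooth_on_cst.
apply: smooth_onD => //; apply: smooth_onM => //.
  exact: smooth_on_cst.
exact: smooth_on_mono_ev.
Qed.

Lemma mono_ev_dmono (i : 'I_4) m x : U x ->
  partial i (mono_ev m) x = \sum_(n <- dmono i m) mono_ev n x.
Proof.
move=> Ux; elim: m => [|a m IH]; first by rewrite big_nil; apply: derive_cst.
rewrite [dmono _ _]/= big_cons big_map insert_atom_ev.
have da := smooth_on_derivable (smooth_on_multi_partial a.2 (sbs a.1)) Ux.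
have dm := smooth_on_derivable (smooth_on_mono_ev m) Ux.
rewrite -[LHS]/('D_(delta_mx ord0 i) (fun y => atom_ev a y * mono_ev m y) x).
rewrite [LHS](deriveM (da _) (dm _)) addrC; congr (_ + _).
  rewrite -[LHS]/(_ * _) mulrC; congr (_ * _).
  exact: (partial_multi_partial i a.2 oU (sbs a.1) Ux).
rewrite -[LHS]/(_ * partial i (mono_ev m) x) IH big_distrr /=.
by apply: eq_bigr => n _; rewrite insert_atom_ev.
Qed.

(** The bridge from computation to analysis: the product rule, applied to each monomial, identifies
    formal derivation of lists with differentiation of their values. *)
Lemma ev_pderive (i : 'I_4) p x : U x -> partial i (ev p) x = ev (pderive i p) x.
Proof.
move=> Ux; elim: p => [|t p IH]; first exact: derive_cst.
have dm := smooth_on_derivable (smooth_on_mono_ev t.2) Ux.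
have dp := smooth_on_derivable (smooth_on_ev p) Ux.
rewrite -[LHS]/('D_(delta_mx ord0 i) (fun y => zr t.1 * mono_ev t.2 y + ev p y) x).
rewrite [LHS](deriveD (derivableM (derivable_cst _ _ _) (dm _)) (dp _)).
rewrite [pderive _ _]/= ev_padd -IH; congr (_ + _).
rewrite (deriveMl _ (dm _)) -[LHS]/(zr t.1 * partial i (mono_ev t.2) x).
rewrite (mono_ev_dmono _ _ Ux).
elim: (dmono i t.2) => [|n l IHl] /=; first by rewrite big_nil mulr0.
by rewrite big_cons -IHl mulrDr.
Qed.

End Evaluation.

(** * Symbolic curvature *)

Section Tables.
Variable T : Type.
Variable d : T.
(** Tensors are stored as lists so that [vm_compute] evaluates each component once; a function would
    be evaluated again at every use. *)
Definition tab1 (f : nat -> T) : seq T := [:: f 0%N; f 1%N; f 2%N; f 3%N].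
Lemma nth_tab1 f (i : 'I_4) : nth d (tab1 f) i = f i.
Proof. by elim/ord4P: i. Qed.
End Tables.

Definition tab2 (f : nat -> nat -> dpoly) := tab1 (fun i => tab1 (f i)).
Definition tab3 (f : nat -> nat -> nat -> dpoly) := tab1 (fun i => tab2 (f i)).
Definition tab4 (f : nat -> nat -> nat -> nat -> dpoly) :=
  tab1 (fun i => tab3 (f i)).
Definition get2 t i j : dpoly := nth [::] (nth [::] t i) j.
Definition get3 t i j k : dpoly := get2 (nth [::] t i) j k.
Definition get4 t i j k l : dpoly := get3 (nth [::] t i) j k l.

Lemma get2E f (i j : 'I_4) : get2 (tab2 f) i j = f i j.
Proof. by rewrite /get2 !nth_tab1. Qed.
Lemma get3E f (i j k : 'I_4) : get3 (tab3 f) i j k = f i j k.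
Proof. by rewrite /get3 nth_tab1 get2E. Qed.
Lemma get4E f (i j k l : 'I_4) : get4 (tab4 f) i j k l = f i j k l.
Proof. by rewrite /get4 nth_tab1 get3E. Qed.

Definition lcz (a b c d : nat) : Z :=
  let s x y := BinInt.Z.sgn (BinInt.Z.sub (znat y) (znat x)) in
  zmul (zmul (zmul (zmul (zmul (s a b) (s a c)) (s a d)) (s b c)) (s b d)) (s c d).

(* Each table holds an integral multiple of the tensor it is named after, the
   multiple being recorded in the specification lemmas below; [G2] stands for
   twice the metric and [GI] for its inverse. *)
Section SymbolicCurvature.
Variables G2 GI : seq (seq dpoly).

Definition gam_poly (i j k : nat) : dpoly :=
  psum4 (fun l => pmul (get2 GI i l)
    (psub (padd (pderive j (get2 G2 l k)) (pderive k (get2 G2 l j)))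
          (pderive l (get2 G2 j k)))).

Variable C : seq (seq (seq dpoly)).

(** Christoffel symbols are a quarter of [C], so over the denominator 16 of their products the
    derivatives acquire a factor 4. *)
Definition riem_poly (i j k l : nat) : dpoly :=
  padd (pscale (znat 4)
         (psub (pderive k (get3 C i l j)) (pderive l (get3 C i k j))))
    (psum4 (fun m => psub (pmul (get3 C i k m) (get3 C m l j))
                          (pmul (get3 C i l m) (get3 C m k j)))).

Variable Rm : seq (seq (seq (seq dpoly))).

Definition ric_poly (j l : nat) : dpoly := psum4 (fun i => get4 Rm i j i l).

Variable Rc : seq (seq dpoly).

Definition ricup_poly (i j : nat) : dpoly :=
  psum4 (fun m => pmul (get2 GI i m) (get2 Rc m j)).

Variable Ru : seq (seq dpoly).

Definition scal_poly : dpoly := psum4 (fun i => get2 Ru i i).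

Variable S : dpoly.

Definition pkron (i j : nat) (p : dpoly) : dpoly := if i == j then p else [::].

(** Over the common denominator 192 = 12 * 16 the coefficient 1/2 becomes 6 for the terms with
    [kron]; with the further half carried by [G2], it becomes 3, and 1/6 becomes 1. *)
Definition weyl_poly (i j k l : nat) : dpoly :=
  padd (psub (psub (pscale (znat 12) (get4 Rm i j k l))
    (pscale (znat 6) (psub (pkron i k (get2 Rc j l)) (pkron i l (get2 Rc j k)))))
    (pscale (znat 3) (psub (pmul (get2 G2 j l) (get2 Ru i k))
                           (pmul (get2 G2 j k) (get2 Ru i l)))))
   (pmul S (psub (pkron i k (get2 G2 j l)) (pkron i l (get2 G2 j k)))).

Variable W : seq (seq (seq (seq dpoly))).

(** Summands with a zero symbol are skipped before any product is formed: 24 of the 256 remain. *)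
Definition hodge_poly (i j k l : nat) : dpoly :=
  psum4 (fun a => psum4 (fun b => psum4 (fun c => psum4 (fun d =>
    let e := lcz a j b d in
    if zeqb e z0 then [::] else
    pmul (pmul (get2 GI i a) (get2 GI b c)) (pscale e (get4 W d c k l)))))).

(** The factor 8 offsets the 1/8 in front of the Hodge dual, which is 1/2 times the volume density
    1/4. *)
Definition half_poly (s : bool) (i j k l : nat) : dpoly :=
  let w := pscale (znat 8) (get4 W i j k l) in
  let h := hodge_poly i j k l in
  if s then padd w h else psub w h.

End SymbolicCurvature.

Definition weyl_table (G2 GI : seq (seq dpoly)) :=
  let C := tab3 (gam_poly G2 GI) in
  let Rm := tab4 (riem_poly C) in
  let Rc := tab2 (ric_poly Rm) in
  let Ru := tab2 (ricup_poly GI Rc) in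
  let S := scal_poly Ru in
  tab4 (weyl_poly G2 Rm Rc Ru S).

Section CurvatureSpec.
Context {R : realType}.
Local Notation V := 'rV[R]_4.
Variables (U : set V) (oU : open U) (bs : nat -> V -> R).
Hypothesis sbs : forall k, smooth_on U (bs k).
Local Notation ev := (ev bs).
Variables (g : V -> 'M[R]_4) (G2 GI : seq (seq dpoly)).
Hypothesis gE : forall x, U x -> forall i j : 'I_4, g x i j = 2^-1 * ev (get2 G2 i j) x.
Hypothesis giE : forall x, U x -> forall i j : 'I_4, ginv g x i j = ev (get2 GI i j) x.
Hypothesis detg : forall x, U x -> Num.sqrt (\det (g x)) = 4^-1.

Let C := tab3 (gam_poly G2 GI).
Let Rm := tab4 (riem_poly C).
Let Rc := tab2 (ric_poly Rm).
Let Ru := tab2 (ricup_poly GI Rc).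
Let S := scal_poly Ru.
Let W := tab4 (weyl_poly G2 Rm Rc Ru S).

Lemma partial_scale (c : R) i p (h : V -> R) x : U x ->
  (forall y, U y -> h y = c * ev p y) ->
  partial i h x = c * ev (pderive i p) x.
Proof.
move=> Ux hE; rewrite (partial_eq_on i oU hE Ux) -(ev_pderive oU sbs i p Ux).
exact: (deriveMl c (smooth_on_derivable (smooth_on_ev oU sbs p) Ux)).
Qed.

Lemma christoffel_spec x i j k : U x ->
  christoffel g i j k x = 4^-1 * ev (get3 C i j k) x.
Proof.
move=> Ux; rewrite /C get3E /gam_poly ev_psum4 /christoffel !big_distrr /=.
apply: eq_bigr => l _; rewrite ev_pmul giE //.
have P a b c := @partial_scale 2^-1 a _ _ x Ux (fun y Uy => @gE y Uy b c).
rewrite !P ev_psub ev_padd; by field.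
Qed.

Lemma riemann_spec x i j k l : U x ->
  riemann g x i j k l = 16^-1 * ev (get4 Rm i j k l) x.
Proof.
move=> Ux; rewrite /Rm get4E /riem_poly ev_padd ev_pscale ev_psub ev_psum4 zr_nat.
have P a b c d := @partial_scale 4^-1 a _ _ x Ux (fun y Uy => @christoffel_spec y b c d Uy).
rewrite /riemann !P mulrDr big_distrr /=; congr (_ + _); first by field.
by apply: eq_bigr => m _; rewrite !christoffel_spec // ev_psub !ev_pmul; by field.
Qed.

Lemma ricci_spec x j l : U x -> ricci g x j l = 16^-1 * ev (get2 Rc j l) x.
Proof.
move=> Ux; rewrite /Rc get2E /ric_poly ev_psum4 /ricci big_distrr /=.
by apply: eq_bigr => i _; rewrite riemann_spec.
Qed.

Lemma ricci_up_spec x i j : U x -> ricci_up g x i j = 16^-1 * ev (get2 Ru i j) x.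
Proof.
move=> Ux; rewrite /Ru get2E /ricup_poly ev_psum4 /ricci_up big_distrr /=.
by apply: eq_bigr => m _; rewrite ricci_spec // giE // ev_pmul mulrCA.
Qed.

Lemma scalar_curvature_spec x : U x -> scalar_curvature g x = 16^-1 * ev S x.
Proof.
move=> Ux; rewrite /S ev_psum4 /scalar_curvature big_distrr /=.
by apply: eq_bigr => m _; rewrite ricci_up_spec.
Qed.

Lemma ev_pkron (i j : 'I_4) p x : ev (pkron i j p) x = kron i j * ev p x.
Proof.
by rewrite /pkron /kron -val_eqE; case: eqP => _; rewrite ?mul1r ?mul0r.
Qed.

Lemma weyl_spec x i j k l : U x ->
  weyl g x i j k l = 192^-1 * ev (get4 W i j k l) x.
Proof.
move=> Ux; rewrite /W get4E /weyl_poly ev_padd !ev_psub !ev_pscale !ev_pmul !ev_psub.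
rewrite !ev_pmul !ev_pkron !zr_nat /weyl riemann_spec // scalar_curvature_spec //.
by rewrite !ricci_spec // !ricci_up_spec // !gE //; by field.
Qed.

Lemma zr_lcz (a b c d : 'I_4) : zr (lcz a b c d) = levi_civita a b c d :> R.
Proof.
rewrite /zr /levi_civita /lcz; congr (_%:~R).
have s (p q : nat) : int_of_Z (BinInt.Z.sgn (BinInt.Z.sub (znat q) (znat p)))
   = sgz (q%:Z - p%:Z).
  by lia.
by rewrite !(rmorphM int_of_Z) /= !s.
Qed.

Lemma hodge_spec x i j k l : U x ->
  hodge g x (weyl g x) i j k l = 1536^-1 * ev (hodge_poly GI W i j k l) x.
Proof.
move=> Ux; rewrite /hodge detg // /hodge_poly ev_psum4 !big_distrr /=.
apply: eq_bigr => a _; rewrite ev_psum4 !big_distrr /=.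
apply: eq_bigr => b _; rewrite ev_psum4 !big_distrr /=.
apply: eq_bigr => c _; rewrite ev_psum4 !big_distrr /=.
apply: eq_bigr => d _; rewrite -zr_lcz !giE // weyl_spec //.
case: ifP => [/zr_eq0 ->|_]; first by rewrite mulr0 mul0r !mulr0.
by rewrite !ev_pmul ev_pscale; by field.
Qed.

Lemma weyl_minus_spec x i j k l : U x ->
  weyl_minus g x i j k l
  = 3072^-1 * ev (half_poly GI (weyl_table G2 GI) false i j k l) x.
Proof.
move=> Ux; rewrite /weyl_minus weyl_spec // hodge_spec // /half_poly.
rewrite ev_psub ev_pscale zr_nat -/W; by field.
Qed.

Lemma weyl_plus_spec x i j k l : U x ->
  weyl_plus g x i j k l
  = 3072^-1 * ev (half_poly GI (weyl_table G2 GI) true i j k l) x.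
Proof.
move=> Ux; rewrite /weyl_plus weyl_spec // hodge_spec // /half_poly.
rewrite ev_padd ev_pscale zr_nat -/W; by field.
Qed.

End CurvatureSpec.

(** * Walker metrics *)

Definition walker_G2 (A B C : dpoly) : seq (seq dpoly) :=
  let o := [::] in let e := pconst (znat 1) in
  let two p := pscale (znat 2) p in let mtwo p := psub [::] (two p) in
  [:: [:: o; o; e; o]; [:: o; o; o; e];
      [:: e; o; mtwo A; two B]; [:: o; e; two B; mtwo C]].

Definition walker_GI (A B C : dpoly) : seq (seq dpoly) :=
  let o := [::] in let e := pconst (znat 2) in
  let four p := pscale (znat 4) p in let mfour p := psub [::] (four p) in
  [:: [:: four A; mfour B; e; o]; [:: mfour B; four C; o; e];
      [:: e; o; o; o]; [:: o; e; o; o]].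

Section WalkerMatrix.
Context {R : realType}.

Definition mx_of_rows (s : seq (seq R)) : 'M[R]_4 :=
  \matrix_(i, j) nth 0 (nth [::] s i) j.

Lemma mx_of_rowsE s (i j : 'I_4) : mx_of_rows s i j = nth 0 (nth [::] s i) j.
Proof. by rewrite mxE. Qed.

Definition walker (a b c : R) : 'M[R]_4 := mx_of_rows
  [:: [:: 0; 0; 2^-1; 0]; [:: 0; 0; 0; 2^-1];
      [:: 2^-1; 0; - a; b]; [:: 0; 2^-1; b; - c]].

Definition walker_inv (a b c : R) : 'M[R]_4 := mx_of_rows
  [:: [:: 4 * a; - (4 * b); 2; 0]; [:: - (4 * b); 4 * c; 0; 2];
      [:: 2; 0; 0; 0]; [:: 0; 2; 0; 0]].

Lemma mulmx4E (M N : 'M[R]_4) (i j : 'I_4) :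
  (M *m N) i j = M i i1 * N i1 j + M i i2 * N i2 j + M i i3 * N i3 j + M i i4 * N i4 j.
Proof.
rewrite mxE !big_ord_recl big_ord0 addr0 !addrA.
by do ?congr (_ + _); congr (M i _ * N _ j); apply: val_inj.
Qed.

Lemma invmx_walker a b c : invmx (walker a b c) = walker_inv a b c.
Proof.
have E : walker a b c *m walker_inv a b c = 1%:M.
  apply/matrixP => i j; rewrite mulmx4E !mx_of_rowsE mxE.
  by elim/ord4P: i; elim/ord4P: j => /=; rewrite ?mulr1n ?mulr0n; field.
have [uW _] := mulmx1_unit E.
by rewrite -[RHS]mul1mx -(mulVmx uW) -mulmxA E mulmx1.
Qed.

Lemma det_trig4 (M : 'M[R]_4) : is_trig_mx M ->
  \det M = M i1 i1 * M i2 i2 * M i3 i3 * M i4 i4.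
Proof.
move=> /det_trig ->; rewrite !big_ord_recl big_ord0 mulr1 !mulrA.
by do ?congr (_ * _); congr (M _ _); apply: val_inj.
Qed.

(* Two block column operations with unit determinant make the matrix lower
   triangular. *)
Lemma det_walker a b c : \det (walker a b c) = 16^-1.
Proof.
pose L := mx_of_rows [:: [:: 1; 0; 0; 0]; [:: 0; 1; 0; 0];
                         [:: 1; 0; 1; 0]; [:: 0; 1; 0; 1]].
pose P := mx_of_rows [:: [:: 1; 0; 0; 0]; [:: 0; 1; 0; 0];
                         [:: -1; 0; 1; 0]; [:: 0; -1; 0; 1]].
pose T := mx_of_rows [:: [:: 2^-1; 0; 0; 0]; [:: 0; 2^-1; 0; 0];
                         [:: 2^-1 - a; b; - 2^-1; 0]; [:: b; 2^-1 - c; 0; - 2^-1]].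
have E : walker a b c *m L *m P^T = T.
  apply/matrixP => i j; rewrite !mulmx4E !mxE.
  by elim/ord4P: i; elim/ord4P: j => /=; field.
have tr (s : seq (seq R)) : (forall i j : 'I_4, (i < j)%N -> nth 0 (nth [::] s i) j = 0) ->
    is_trig_mx (mx_of_rows s).
  by move=> h; apply/is_trig_mxP => i j ij; rewrite mxE h.
have dL : \det L = 1.
  rewrite det_trig4 ?mx_of_rowsE /= ?mulr1 //; apply: tr => i j.
  by elim/ord4P: i; elim/ord4P: j.
have dP : \det P^T = 1.
  rewrite det_tr det_trig4 ?mx_of_rowsE /= ?mulr1 //; apply: tr => i j.
  by elim/ord4P: i; elim/ord4P: j.
have dT : \det T = 16^-1.
  rewrite det_trig4 ?mx_of_rowsE /=; first by field.
  by apply: tr => i j; elim/ord4P: i; elim/ord4P: j.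
by have := congr1 determinant E; rewrite !det_mulmx dL dP dT !mulr1.
Qed.

Lemma sqrt_det_walker a b c : Num.sqrt (\det (walker a b c)) = 4^-1.
Proof.
rewrite det_walker (_ : 16^-1 = 4^-1 ^+ 2 :> R); last by field.
by rewrite sqrtr_sqr ger0_norm // invr_ge0.
Qed.

Lemma metricE (f : jet1 R -> R) u x : metric f u x =
  walker (f (jet u x) * partial2 i2 i2 u x) (f (jet u x) * partial2 i1 i2 u x)
         (f (jet u x) * partial2 i1 i1 u x).
Proof.
by apply/matrixP => i j; rewrite !mxE; elim/ord4P: i; elim/ord4P: j.
Qed.

Lemma flat_ev0 (a : R) : 3072^-1 * a = 0 -> a = 0.
Proof. by move=> /eqP; rewrite mulf_eq0 invr_eq0 pnatr_eq0 => /eqP. Qed.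

End WalkerMatrix.

Section WalkerWeyl.
Context {R : realType}.
Local Notation V := 'rV[R]_4.
Variables (U : set V) (oU : open U) (bs : nat -> V -> R).
Hypothesis sbs : forall k, smooth_on U (bs k).
Variables (f : jet1 R -> R) (u : V -> R) (A B C : dpoly).
Hypothesis AE : forall x, U x -> f (jet u x) * partial2 i2 i2 u x = ev bs A x.
Hypothesis BE : forall x, U x -> f (jet u x) * partial2 i1 i2 u x = ev bs B x.
Hypothesis CE : forall x, U x -> f (jet u x) * partial2 i1 i1 u x = ev bs C x.

Lemma metric_walker x : U x ->
  metric f u x = walker (ev bs A x) (ev bs B x) (ev bs C x).
Proof.
move=> Ux.
apply: (etrans (metricE f u x)).
congr (walker _ _ _).
- exact: AE.
- exact: BE.
- exact: CE.
Qed.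

Lemma walker_G2_spec x : U x -> forall i j : 'I_4,
  metric f u x i j = 2^-1 * ev bs (get2 (walker_G2 A B C) i j) x.
Proof.
move=> Ux i j; rewrite metric_walker // mx_of_rowsE. 
elim/ord4P: i; elim/ord4P: j; rewrite /get2 /= ?ev_psub ?ev_pscale ?ev_pconst ?ev_nil ?zr_nat; by field.
Qed.

Lemma walker_GI_spec x : U x -> forall i j : 'I_4,
  ginv (metric f u) x i j = ev bs (get2 (walker_GI A B C) i j) x.
Proof.
move=> Ux i j; rewrite /ginv metric_walker // invmx_walker mx_of_rowsE.
elim/ord4P: i; elim/ord4P: j; rewrite /get2 /= ?ev_psub ?ev_pscale ?ev_pconst ?ev_nil ?zr_nat; by field.
Qed.

Lemma sqrt_det_metric x : U x -> Num.sqrt (\det (metric f u x)) = 4^-1.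
Proof. by move=> _; rewrite metricE sqrt_det_walker. Qed.

(** [A], [B], [C] are left arbitrary for two encodings: integer multiples of one unknown function
    for the test solutions, and products of [f] with second derivatives of [u] for general ones. *)
Definition walker_half (A B C : dpoly) (s : bool) (i j k l : nat) : dpoly :=
  half_poly (walker_GI A B C)
    (weyl_table (walker_G2 A B C) (walker_GI A B C)) s i j k l.

Lemma weyl_minus_metric x i j k l : U x ->
  weyl_minus (metric f u) x i j k l = 3072^-1 * ev bs (walker_half A B C false i j k l) x.
Proof.
exact: (weyl_minus_spec oU sbs walker_G2_spec walker_GI_spec sqrt_det_metric).
Qed.

Lemma weyl_plus_metric x i j k l : U x ->
  weyl_plus (metric f u) x i j k l = 3072^-1 * ev bs (walker_half A B C true i j k l) x.
Proof.
exact: (weyl_plus_spec oU sbs walker_G2_spec walker_GI_spec sqrt_det_metric).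
Qed.

End WalkerWeyl.

(** * Functions of the first jet *)

Section JetChainRule.
Context {R : realType}.
Local Notation V := 'rV[R]_4.
Local Notation J := (jet1 R).
Implicit Types (U : set V) (D : set J) (u : V -> R) (G : J -> R).

Definition dir_x (i : 'I_4) : J := (delta_mx ord0 i, 0, 0).
Definition dir_u : J := (0, 1, 0).
Definition dir_p (k : 'I_4) : J := (0, 0, delta_mx ord0 k).

Lemma jet_decomp (v : J) :
  v = \sum_i v.1.1 ord0 i *: dir_x i + v.1.2 *: dir_u
      + \sum_k v.2 ord0 k *: dir_p k.
Proof.
have fst_sum (h : 'I_4 -> J) : (\sum_i h i).1 = \sum_i (h i).1.
  by rewrite (big_morph _ (fun x y => erefl (x + y).1) (erefl (0 : J).1)).
have snd_sum (h : 'I_4 -> J) : (\sum_i h i).2 = \sum_i (h i).2.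
  by rewrite (big_morph _ (fun x y => erefl (x + y).2) (erefl (0 : J).2)).
have fst_sum' (h : 'I_4 -> V * R) : (\sum_i h i).1 = \sum_i (h i).1.
  by rewrite (big_morph _ (fun x y => erefl (x + y).1) (erefl (0 : V * R).1)).
have snd_sum' (h : 'I_4 -> V * R) : (\sum_i h i).2 = \sum_i (h i).2.
  by rewrite (big_morph _ (fun x y => erefl (x + y).2) (erefl (0 : V * R).2)).
case: v => [[a b] c] /=.
apply: injective_projections; [apply: injective_projections|].
- rewrite /= !fst_sum /= !fst_sum' /= scaler0 addr0.
  rewrite [X in _ = _ + X]big1 ?addr0; last by move=> k _; rewrite scaler0.
  exact: row_sum_delta.
- rewrite /= !fst_sum /= !snd_sum' /=.
  rewrite big1 ?add0r; last by move=> k _; rewrite scaler0.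
  rewrite [X in _ = _ + X]big1 ?addr0; last by move=> k _; rewrite scaler0.
  by rewrite [_%:A]mulr1.
- rewrite /= !snd_sum /= scaler0 addr0.
  rewrite [X in _ = X + _]big1 ?add0r; last by move=> k _; rewrite scaler0.
  exact: row_sum_delta.
Qed.

Lemma derive_jet_decomp G z (v : J) : differentiable G z ->
  'D_v G z = \sum_i v.1.1 ord0 i * 'D_(dir_x i) G z + v.1.2 * 'D_dir_u G z
             + \sum_k v.2 ord0 k * 'D_(dir_p k) G z.
Proof.
move=> dG; rewrite deriveE // {1}[v]jet_decomp !linearD !linear_sum.
rewrite linearZ deriveE //; congr (_ + _ + _).
  by apply: eq_bigr => i _; rewrite linearZ deriveE.
by apply: eq_bigr => i _; rewrite linearZ deriveE.
Qed.

Definition gradient u (x : V) : V := \row_(i < 4) partial i u x.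

Lemma differentiable_gradient U u x : smooth_on U u -> U x ->
  differentiable (gradient u) x.
Proof.
move=> su Ux.
rewrite (_ : gradient u = \sum_i (fun y => partial i u y *: (delta_mx ord0 i : V))).
  apply: differentiable_sum => i; apply: differentiableZl.
  exact: smooth_on_diff (smooth_on_partial i su) _ Ux.
apply/funext => y; rewrite fct_sumE [LHS]row_sum_delta.
by apply: eq_bigr => i _; rewrite mxE.
Qed.

Lemma differentiable_jet U u x : smooth_on U u -> U x -> differentiable (jet u) x.
Proof.
move=> su Ux; apply: differentiable_pair; last exact: differentiable_gradient su Ux.
apply: differentiable_pair => //; exact: smooth_on_diff su _ Ux.
Qed.

Lemma derive_jet U u x v : smooth_on U u -> U x ->
  'd (jet u) x v = (v, 'D_v u x, \row_i 'D_v (partial i u) x).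
Proof.
move=> su Ux; have du := smooth_on_diff su Ux.
have dg := differentiable_gradient su Ux.
have did : differentiable (fun y : V => y) x by [].
have dp : differentiable (fun y => (y, u y)) x by apply: differentiable_pair.
have E1 : 'd (jet u) x v = ('d (fun y => (y, u y)) x v, 'd (gradient u) x v).
  by rewrite (diff_pair dp dg).
have E2 : 'd (fun y => (y, u y)) x v = ('d (fun y : V => y) x v, 'd u x v).
  by rewrite (diff_pair did du).
have E3 : 'd (fun y : V => y) x v = v by rewrite -(deriveE _ did) derive_id.
have E4 : 'd u x v = 'D_v u x by rewrite deriveE.
have E5 : 'd (gradient u) x v = 'D_v (gradient u) x by rewrite deriveE.
apply: (etrans E1); apply: f_equal2.
  apply: (etrans E2); exact: f_equal2 E3 E4.
apply: (etrans E5).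
have E6 := derive_mx (v := v) (diff_derivable dg).
apply: (etrans E6).
apply/rowP => k; rewrite !mxE; congr ('D_v _ x).
by apply/funext => y; rewrite mxE.
Qed.

Lemma derive_comp_jet U u G x v : smooth_on U u -> U x ->
  differentiable G (jet u x) ->
  'D_v (G \o jet u) x = \sum_i v ord0 i * 'D_(dir_x i) G (jet u x)
    + 'D_v u x * 'D_dir_u G (jet u x)
    + \sum_k 'D_v (partial k u) x * 'D_(dir_p k) G (jet u x).
Proof.
move=> su Ux dG; have dj := differentiable_jet su Ux.
rewrite deriveE; last exact: differentiable_comp.
rewrite diff_comp //= (derive_jet _ su Ux) -deriveE // derive_jet_decomp //=.
by congr (_ + _); apply: eq_bigr => k _; rewrite mxE.
Qed.

Lemma partial_comp_jet U u G x i : smooth_on U u -> U x ->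
  differentiable G (jet u x) ->
  partial i (G \o jet u) x = 'D_(dir_x i) G (jet u x)
    + partial i u x * 'D_dir_u G (jet u x)
    + \sum_k partial i (partial k u) x * 'D_(dir_p k) G (jet u x).
Proof.
move=> su Ux dG; rewrite /partial (derive_comp_jet _ su Ux) //; congr (_ + _ + _).
rewrite (bigD1 i) //= mxE !eqxx mul1r big1 ?addr0 // => j ji.
by rewrite mxE eqxx (negPf ji) mul0r.
Qed.

Lemma smooth_upto_sum4 n U (h : 'I_4 -> V -> R) : open U ->
  (forall i, smooth_upto n U (h i)) -> smooth_upto n U (fun x => \sum_i h i x).
Proof.
move=> oU sh.
apply: (smooth_upto_eq oU (f := fun x => h i1 x + (h i2 x + (h i3 x + h i4 x)))).
  move=> x _; rewrite !big_ord_recl big_ord0 addr0.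
  by congr (h _ x + (h _ x + (h _ x + h _ x))); apply: val_inj.
exact: (smooth_uptoD oU (sh i1) (smooth_uptoD oU (sh i2) (smooth_uptoD oU (sh i3) (sh i4)))).
Qed.

(** The derivative of [G \o jet u] combines functions ['D_w G \o jet u] with smooth coefficients, so
    the induction on the order runs over all [G] at once. *)
Lemma smooth_on_comp_jet U D u G : open U -> smooth_on U u -> smooth_on D G ->
  (forall x, U x -> D (jet u x)) -> smooth_on U (G \o jet u).
Proof.
move=> oU su sG UD; apply/smooth_uptoP => n; elim: n G sG => [|n IH] G sG.
  apply/smooth_upto0 => x Ux; apply: differentiable_comp.
    exact: differentiable_jet su Ux.
  exact: smooth_on_diff sG _ (UD _ Ux).
have dGj x : U x -> differentiable (G \o jet u) x.
  move=> Ux; apply: differentiable_comp; first exact: differentiable_jet su Ux.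
  exact: smooth_on_diff sG _ (UD _ Ux).
apply/smooth_uptoS; split=> // v.
have sM (h k : V -> R) := @smooth_uptoM _ _ n U h k oU.
have sDG w : smooth_upto n U ('D_w G \o jet u).
  by apply: IH; apply: smooth_on_derive.
have sc (c : R) := @smooth_upto_cst _ _ n U c.
have sO (h : V -> R) : smooth_on U h -> smooth_upto n U h by move=> /smooth_uptoP.
have sDu : smooth_upto n U ('D_v u) by apply: (sO); apply: smooth_on_derive.
have sDp k : smooth_upto n U ('D_v (partial k u)).
  by apply: (sO); apply: smooth_on_derive; apply: smooth_on_partial.
have := smooth_uptoD oU (smooth_uptoD oU
  (smooth_upto_sum4 oU (fun i => sM _ _ (sc (v ord0 i)) (sDG (dir_x i))))
  (sM _ _ sDu (sDG dir_u)))
  (smooth_upto_sum4 oU (fun k => sM _ _ (sDp k) (sDG (dir_p k)))).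
apply: smooth_upto_eq => // x Ux.
by rewrite (derive_comp_jet _ su Ux) //; apply: smooth_on_diff sG _ (UD _ Ux).
Qed.

End JetChainRule.

(** * Substitution in differential polynomials, and algebras closed under derivation *)

Definition psubst (s : atom -> dpoly) (p : dpoly) : dpoly :=
  foldr (fun t r => padd (pscale t.1
    (foldr (fun a q => pmul (s a) q) (pconst (znat 1)) t.2)) r) [::] p.

Definition apply_rules (rs : seq (atom * dpoly)) (a : atom) : dpoly :=
  foldr (fun r q => if r.1 == a then r.2 else q) (patom a.1 a.2) rs.

Section Substitution.
Context {R : realType}.
Local Notation V := 'rV[R]_4.
Implicit Types (bs : nat -> V -> R).

Lemma ev_psubst bs bs' s p x :
  (forall a, atom_ev bs a x = ev bs' (s a) x) ->
  ev bs' (psubst s p) x = ev bs p x.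
Proof.
move=> sE; elim: p => //= t p IH.
rewrite ev_padd ev_pscale IH; congr (_ * _ + _).
elim: (t.2) => [|a m IHm].
  by rewrite [LHS](ev_pconst bs' (znat 1) x) zr_nat.
by rewrite /= ev_pmul IHm sE.
Qed.

Lemma atom_ev_patom bs a x : atom_ev bs a x = ev bs (patom a.1 a.2) x.
Proof. by rewrite ev_patom. Qed.

Lemma ev_apply_rules bs rs x a :
  (forall r, r \in rs -> atom_ev bs r.1 x = ev bs r.2 x) ->
  atom_ev bs a x = ev bs (apply_rules rs a) x.
Proof.
elim: rs => [|r rs IH] rsE; first exact: atom_ev_patom.
rewrite /=; case: eqP => [<-|_]; first by apply: rsE; rewrite mem_head.
by apply: IH => r' r'rs; apply: rsE; rewrite in_cons r'rs orbT.
Qed.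

Lemma ev_psubst_rules bs rs p x :
  (forall r, r \in rs -> atom_ev bs r.1 x = ev bs r.2 x) ->
  ev bs (psubst (apply_rules rs) p) x = ev bs p x.
Proof. by move=> rsE; apply: ev_psubst => a; apply: ev_apply_rules. Qed.

Lemma derive_rule U bs (i : 'I_4) a p : open U -> (forall k, smooth_on U (bs k)) ->
  (forall x, U x -> atom_ev bs a x = ev bs p x) ->
  forall x, U x -> atom_ev bs (incr i a) x = ev bs (pderive i p) x.
Proof.
move=> oU sbs aE x Ux; rewrite -(ev_pderive oU sbs i p Ux).
rewrite -(partial_eq_on i oU aE Ux).
exact: esym (partial_multi_partial i a.2 oU (sbs a.1) Ux).
Qed.

End Substitution.

(* [cderive dt i] is the derivation of polynomials in the base functions that
   sends the [k]-th base function to [dt i k]. *)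
Section ClosedDerivation.
Variable dt : nat -> nat -> dpoly.

Definition first_order (a : atom) : dpoly :=
  if a.2 == [:: 1%N] then dt 0 a.1
  else if a.2 == [:: 0%N; 1%N] then dt 1 a.1
  else if a.2 == [:: 0%N; 0%N; 1%N] then dt 2 a.1
  else if a.2 == [:: 0%N; 0%N; 0%N; 1%N] then dt 3 a.1
  else patom a.1 a.2.

Definition cderive (i : nat) (p : dpoly) : dpoly :=
  psubst first_order (pderive i p).

Lemma partial_cderive {R : realType} (U : set 'rV[R]_4) bs (i : 'I_4) p :
  open U -> (forall k, smooth_on U (bs k)) ->
  (forall (j : 'I_4) k x, U x -> partial j (bs k) x = ev bs (dt j k) x) ->
  forall x, U x -> partial i (ev bs p) x = ev bs (cderive i p) x.
Proof.
move=> oU sbs dtE x Ux; rewrite (ev_pderive oU sbs) // /cderive (@ev_psubst _ bs) //.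
case=> k s; rewrite /first_order /=.
case: eqP => [->|_]; first exact: (dtE i1).
case: eqP => [->|_]; first exact: (dtE i2).
case: eqP => [->|_]; first exact: (dtE i3).
case: eqP => [->|_]; first exact: (dtE i4).
exact: atom_ev_patom.
Qed.

End ClosedDerivation.

Section Coordinates.
Context {R : realType}.
Local Notation V := 'rV[R]_4.

(** Slot 4 is for a function whose partial derivatives are polynomials in the base functions, such
    as the inverse of a polynomial. Later slots hold symbolic parameters, which are 0 beyond the end
    of [c]. *)
Definition coord_base (x0 : V) (w : V -> R) (c : seq R) (k : nat) : V -> R :=
  match k with
  | 0 => fun x => x ord0 i1 - x0 ord0 i1
  | 1 => fun x => x ord0 i2 - x0 ord0 i2
  | 2 => fun x => x ord0 i3 - x0 ord0 i3
  | 3 => fun x => x ord0 i4 - x0 ord0 i4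
  | 4 => w
  | k'.+4.+1 => cst (nth 0 c k')
  end.

Definition coord_dt (dw : nat -> dpoly) (i k : nat) : dpoly :=
  if (k < 4)%N then (if i == k then pconst (znat 1) else [::])
  else if k == 4%N then dw i else [::].

Lemma derive_coord_dir (a : R) (i : 'I_4) (v x : V) :
  'D_v (fun y : V => y ord0 i - a) x = v ord0 i.
Proof. by apply: derive_affine => h; rewrite !mxE -addrA addrC. Qed.

Lemma derive_coord (a : R) (i j : 'I_4) (x : V) :
  partial j (fun y : V => y ord0 i - a) x = (i == j)%:R.
Proof. by rewrite /partial derive_coord_dir mxE eqxx. Qed.

Lemma smooth_on_coord (U : set V) (a : R) i : smooth_on U (fun y : V => y ord0 i - a).
Proof.
have d x : differentiable (fun y : V => y ord0 i - a) x.
  by apply: differentiableB => //; apply: differentiable_coord.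
apply/smooth_uptoP; case=> [|n]; first by apply/smooth_upto0.
apply/smooth_uptoS; split=> // v.
rewrite (_ : 'D_v _ = cst (v ord0 i)); first exact: smooth_upto_cst.
by apply/funext => x; apply: derive_coord_dir.
Qed.

Variables (U : set V) (oU : open U) (x0 : V) (w : V -> R) (dw : nat -> dpoly).
Variable c : seq R.
Hypothesis sw : smooth_on U w.
Local Notation bs := (coord_base x0 w c).
Hypothesis wE : forall (j : 'I_4) x, U x -> partial j w x = ev bs (dw j) x.

Lemma smooth_on_coord_base k : smooth_on U (bs k).
Proof.
case: k => [|[|[|[|[|k]]]]] //=; try exact: smooth_on_coord.
exact: smooth_on_cst.
Qed.

Lemma coord_dtE (j : 'I_4) k x : U x ->
  partial j (bs k) x = ev bs (coord_dt dw j k) x.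
Proof.
move=> Ux; case: k => [|[|[|[|[|k]]]]]; rewrite /coord_dt /=; last 2 first.
- exact: wE.
- exact: derive_cst.
all: rewrite derive_coord -val_eqE eq_sym /=.
all: by case: eqP => _; rewrite ?ev_pconst ?zr_nat.
Qed.

Lemma partial_coord (i : 'I_4) p x : U x ->
  partial i (ev bs p) x = ev bs (cderive (coord_dt dw) i p) x.
Proof.
move=> Ux; apply: (partial_cderive i p oU smooth_on_coord_base coord_dtE Ux).
Qed.

Lemma partial2_coord (i j : 'I_4) p x : U x ->
  partial i (partial j (ev bs p)) x
  = ev bs (cderive (coord_dt dw) i (cderive (coord_dt dw) j p)) x.
Proof.
move=> Ux; rewrite (partial_eq_on i oU (@partial_coord j p) Ux).
exact: partial_coord.
Qed.

End Coordinates.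

(** * Local solutions *)

Section PartialRules.
Context {R : realType}.
Local Notation V := 'rV[R]_4.
Implicit Types (U : set V) (f g : V -> R).

Lemma partialD U f g i x : smooth_on U f -> smooth_on U g -> U x ->
  partial i (fun y => f y + g y) x = partial i f x + partial i g x.
Proof.
move=> sf sg Ux.
exact: (deriveD (smooth_on_derivable sf Ux) (smooth_on_derivable sg Ux)).
Qed.

Lemma partialM U f g i x : smooth_on U f -> smooth_on U g -> U x ->
  partial i (fun y => f y * g y) x = partial i f x * g x + f x * partial i g x.
Proof.
move=> sf sg Ux.
have E := deriveM (smooth_on_derivable (v := delta_mx ord0 i) sf Ux) (smooth_on_derivable sg Ux).
by rewrite addrC [partial i f x * _]mulrC; apply: E.
Qed.

Lemma big_ord4 (h : 'I_4 -> R) : \sum_i h i = h i1 + h i2 + h i3 + h i4.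
Proof.
rewrite !big_ord_recl big_ord0 addr0 !addrA.
by do ?congr (_ + _); congr (h _); apply: val_inj.
Qed.

Lemma smooth_on_sum4 U (h : 'I_4 -> V -> R) : open U ->
  (forall k, smooth_on U (h k)) -> smooth_on U (fun y => \sum_k h k y).
Proof.
move=> oU sh; apply/smooth_uptoP => n; apply: smooth_upto_sum4 => // k.
by move: n; apply/smooth_uptoP.
Qed.

Lemma partial_sum4 U (h : 'I_4 -> V -> R) i x : open U ->
  (forall k, smooth_on U (h k)) -> U x ->
  partial i (fun y => \sum_k h k y) x = \sum_k partial i (h k) x.
Proof.
move=> oU sh Ux.
rewrite (partial_eq_on i oU (f := fun y => \sum_k h k y)
   (g := fun y => h i1 y + h i2 y + h i3 y + h i4 y)) //; last first.
  by move=> y _; rewrite big_ord4.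
have s12 := smooth_onD oU (sh i1) (sh i2).
rewrite (partialD i (smooth_onD oU s12 (sh i3)) (sh i4) Ux).
by rewrite (partialD i s12 (sh i3) Ux) (partialD i (sh i1) (sh i2) Ux) big_ord4.
Qed.

End PartialRules.

Section JetSecondOrder.
Context {R : realType}.
Local Notation V := 'rV[R]_4.
Local Notation J := (jet1 R).
Variables (U : set V) (D : set J) (u : V -> R).
Hypotheses (oU : open U) (su : smooth_on U u) (UD : forall x, U x -> D (jet u x)).

Definition jet_derive (i : 'I_4) (G : J -> R) (x : V) : R :=
  'D_(dir_x i) G (jet u x) + partial i u x * 'D_dir_u G (jet u x)
  + \sum_k partial i (partial k u) x * 'D_(dir_p k) G (jet u x).

Lemma partial_jet_derive G i x : smooth_on D G -> U x ->
  partial i (G \o jet u) x = jet_derive i G x.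
Proof.
move=> sG Ux; apply: (partial_comp_jet i su Ux).
exact: smooth_on_diff sG _ (UD Ux).
Qed.

(** The grouping confines the third derivatives of [u] to the last sum, where they multiply the
    derivatives of [G] in the gradient directions; test solutions can vary them separately. *)
Lemma partial2_jet_derive G i x : smooth_on D G -> U x ->
  partial i (partial i (G \o jet u)) x =
    jet_derive i ('D_(dir_x i) G) x + partial i u x * jet_derive i ('D_dir_u G) x
    + \sum_k partial i (partial k u) x * jet_derive i ('D_(dir_p k) G) x
    + partial i (partial i u) x * 'D_dir_u G (jet u x)
    + \sum_k partial i (partial i (partial k u)) x * 'D_(dir_p k) G (jet u x).
Proof.
move=> sG Ux.
have sD w := smooth_on_derive w sG.
have sc w := smooth_on_comp_jet oU su (sD w) UD.
have sp k := smooth_on_partial k su.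
have spp k := smooth_on_partial i (sp k).
have sm1 := smooth_onM oU (sp i) (sc dir_u).
have sm2 k := smooth_onM oU (spp k) (sc (dir_p k)).
rewrite (partial_eq_on i oU (fun y Uy => @partial_jet_derive G i y sG Uy) Ux).
rewrite [LHS](partialD i (smooth_onD oU (sc (dir_x i)) sm1)
  (smooth_on_sum4 oU sm2) Ux).
rewrite (partialD i (sc (dir_x i)) sm1 Ux) (partialM i (sp i) (sc dir_u) Ux).
rewrite (partial_sum4 i oU sm2 Ux).
under eq_bigr do rewrite (partialM i (spp _) (sc (dir_p _)) Ux).
have E w : partial i ('D_w G \o jet u) x = jet_derive i ('D_w G) x.
  exact: partial_jet_derive (sD w) Ux.
(* Stated for arbitrary numbers, so that [ring] meets no derivatives. *)
have key (a1 a1' a2 a2' b c d : R) (e m h k k' : 'I_4 -> R) :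
    a1 = a1' -> a2 = a2' -> (forall l, k l = k' l) ->
    a1 + (b * c + d * a2) + \sum_l (e l * m l + h l * k l) =
    a1' + d * a2' + \sum_l h l * k' l + b * c + \sum_l e l * m l.
  move=> -> -> kk; rewrite big_split /=.
  under [X in _ + (_ + X) = _]eq_bigr do rewrite kk.
  ring.
by apply: key => [||l]; apply: E.
Qed.

End JetSecondOrder.

Section LocalSolutions.
Context {R : realType}.
Local Notation V := 'rV[R]_4.
Local Notation J := (jet1 R).
Variables (D : set J) (f : J -> R).
Hypotheses (D_open : open D).

Lemma open_jet_preimage (U : set V) u : open U -> smooth_on U u ->
  open (U `&` jet u @^-1` D).
Proof.
move=> oU su; rewrite openE => x [Ux Dx].
apply: filterI; first exact: open_nbhs_nbhs.
have := differentiable_continuous (differentiable_jet su Ux).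
by apply; apply: open_nbhs_nbhs.
Qed.

Definition affine_poly : dpoly :=
  padd (patom 5 [::]) (psum4 (fun k => pmul (patom (6 + k) [::]) (patom k [::]))).

Lemma ev_affine_poly (x0 : V) w (b l1 l2 l3 l4 : R) :
  ev (coord_base x0 w [:: b; l1; l2; l3; l4]) affine_poly x0 = b.
Proof.
rewrite /affine_poly ev_padd ev_psum4 big_ord4 !ev_pmul !ev_patom.
by rewrite /multi_partial /= !subrr !mulr0 !addr0.
Qed.

(** An affine function corrects the value and the gradient at [x0] without touching the second
    derivatives. *)
Lemma prescribe_jet (U : set V) u0 x0 v0 p0 : open U -> smooth_on U u0 -> U x0 ->
  exists u, [/\ smooth_on U u, jet u x0 = (x0, v0, p0) &
    forall i j x, U x -> partial i (partial j u) x = partial i (partial j u0) x].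
Proof.
move=> oU su0 Ux0.
pose c := [:: v0 - u0 x0; p0 ord0 i1 - partial i1 u0 x0; p0 ord0 i2 - partial i2 u0 x0;
  p0 ord0 i3 - partial i3 u0 x0; p0 ord0 i4 - partial i4 u0 x0].
pose bs := coord_base x0 (cst 0 : V -> R) c.
have sw : smooth_on U (cst 0 : V -> R) by apply: smooth_on_cst.
have wE (j : 'I_4) x : U x -> partial j (cst 0 : V -> R) x = ev bs [::] x.
  by move=> _; apply: derive_cst.
have sb := smooth_on_coord_base x0 c sw.
have sa := smooth_on_ev oU sb affine_poly.
have da (i : 'I_4) x : U x ->
    partial i (ev bs affine_poly) x = p0 ord0 i - partial i u0 x0.
  move=> Ux; apply: (etrans (partial_coord oU sw wE i affine_poly Ux)).
  have E : cderive (coord_dt (fun=> [::])) i affine_poly = patom (6 + i) [::].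
    by elim/ord4P: i; vm_compute.
  apply: (etrans (congr1 (fun p => ev bs p x) E)).
  by rewrite ev_patom; move: i {E}; apply: ord4P.
have du (i : 'I_4) x : U x -> partial i (fun y => u0 y + ev bs affine_poly y) x
    = partial i u0 x + (p0 ord0 i - partial i u0 x0).
  by move=> Ux; rewrite (partialD i su0 sa Ux) da.
exists (fun y => u0 y + ev bs affine_poly y); split.
- exact: smooth_onD.
- rewrite /jet; congr (_, _, _).
    by rewrite ev_affine_poly; apply: subrKC.
  by apply/rowP => i; rewrite mxE du // addrC subrK.
- move=> i j x Ux; rewrite (partial_eq_on i oU (du j) Ux).
  have sc : smooth_on U (cst (p0 ord0 j - partial j u0 x0)) by apply: smooth_on_cst.
  rewrite (partialD i (smooth_on_partial j su0) sc Ux).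
  by rewrite [X in _ + X]derive_cst addr0.
Qed.

(** The jets of a solution have to stay in [D]; the preimage of [D] under the jet is open, so the
    domain can be cut down to it. *)
Lemma solution_restrict (U : set V) u : open U -> smooth_on U u ->
  (forall x, U x -> D (jet u x) -> pde_lhs f u x = 0) ->
  solution f D (U `&` jet u @^-1` D) u.
Proof.
move=> oU su pde; split.
- exact: open_jet_preimage.
- by apply: smooth_on_sub su => x [].
- by move=> x [Ux Dx]; split=> //; apply: pde.
Qed.

Definition poly_derive := cderive (coord_dt (fun=> [::])).

Definition is_developable (q : dpoly) : bool :=
  let d := poly_derive in
  (padd (d 0%N (d 2 q)) (d 1%N (d 3 q)) == [::]) &&
  (psub (pmul (d 0%N (d 0%N q)) (d 1%N (d 1%N q)))
        (pmul (d 0%N (d 1%N q)) (d 0%N (d 1%N q))) == [::]).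

Lemma pde_zero (F p q r s t p' q' r' s' t' : R) :
  p = p' -> q = q' -> r = r' -> s = s' -> t = t' ->
  p' + q' = 0 -> r' * s' - t' * t' = 0 -> p + q + F * (r * s - t ^+ 2) = 0.
Proof. by move=> -> -> -> -> -> pq rst; rewrite pq expr2 rst mulr0 addr0. Qed.

(* Such a [q] solves the equation whatever [f] is. *)
Lemma developable_solution q x0 v0 p0 : is_developable q -> D (x0, v0, p0) ->
  exists U u, [/\ solution f D U u, U x0, jet u x0 = (x0, v0, p0) &
    forall (i j : 'I_4) x, U x -> partial i (partial j u) x
      = ev (coord_base x0 (cst 0) [::]) (poly_derive i (poly_derive j q)) x].
Proof.
move=> /andP[/eqP q0 /eqP qdet] Dz.
pose bs := coord_base x0 (cst 0 : V -> R) [::].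
have oT : open (@setT V) by apply: openT.
have sw : smooth_on setT (cst 0 : V -> R) by apply: smooth_on_cst.
have wE (j : 'I_4) x : setT x -> partial j (cst 0 : V -> R) x = ev bs [::] x.
  by move=> _; apply: derive_cst.
have sb := smooth_on_coord_base x0 [::] sw.
have [u [su ju uE]] := prescribe_jet v0 p0 oT (smooth_on_ev oT sb q) (I : setT x0).
have dE (i j : 'I_4) x : partial i (partial j u) x
      = ev bs (poly_derive i (poly_derive j q)) x.
  rewrite uE //.
  exact: (@partial2_coord R setT oT x0 (cst 0) (fun=> [::]) [::] sw wE i j q x I).
exists (setT `&` jet u @^-1` D), u; split=> //; last first.
  by split=> //=; rewrite ju.
apply: solution_restrict => // x _ _; rewrite /pde_lhs /partial2.
apply: (pde_zero _ (dE i1 i3 x) (dE i2 i4 x) (dE i1 i1 x) (dE i2 i2 x) (dE i1 i2 x)).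
  by rewrite -ev_padd q0.
by rewrite -!ev_pmul -ev_psub qdet.
Qed.

Definition is_test_poly (q : dpoly) (a11 a12 a22 : nat) : bool :=
  let d := poly_derive in
  [&& is_developable q, d 0%N (d 0%N q) == pconst (znat a11),
      d 0%N (d 1%N q) == pconst (znat a12) & d 1%N (d 1%N q) == pconst (znat a22)].

Definition single_base (F : V -> R) (k : nat) : V -> R :=
  if k is 0 then F else cst 0.

(** The second derivatives in x1, x2 are constants here, so the metric is built from a single
    unknown function, [f \o jet u] in slot 0. *)
Definition test_half (a11 a12 a22 : nat) :=
  let p a := pmul (pconst (znat a)) (patom 0 [::]) in
  walker_half (p a22) (p a12) (p a11) false.

Hypothesis f_smooth : smooth_on D f.
Hypothesis flat : forall U u, solution f D U u -> forall x, U x ->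
     forall i j k l, weyl_minus (metric f u) x i j k l = 0.

Lemma test_flat q a11 a12 a22 x0 v0 p0 : is_test_poly q a11 a12 a22 ->
  D (x0, v0, p0) ->
  exists U u, [/\ solution f D U u, U x0, jet u x0 = (x0, v0, p0),
    (forall (i j : 'I_4) x, U x -> partial i (partial j u) x
      = ev (coord_base x0 (cst 0) [::]) (poly_derive i (poly_derive j q)) x) &
    forall i j k l : 'I_4,
      ev (single_base (f \o jet u)) (test_half a11 a12 a22 i j k l) x0 = 0].
Proof.
move=> /and4P[dq /eqP q11 /eqP q12 /eqP q22] Dz.
have [U [u [sol Ux0 ju dE]]] := developable_solution dq Dz.
have [oU su solP] := sol.
have sb k : smooth_on U (single_base (f \o jet u) k).
  case: k => [|k] /=; last exact: smooth_on_cst.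
  by apply: (smooth_on_comp_jet oU su f_smooth) => x /solP[].
exists U, u; split=> // i j k l.
have pE a (i' j' : 'I_4) : poly_derive i' (poly_derive j' q) = pconst (znat a) ->
    forall x, U x -> f (jet u x) * partial2 i' j' u x =
      ev (single_base (f \o jet u)) (pmul (pconst (znat a)) (patom 0 [::])) x.
  move=> qa x Ux; rewrite /partial2 dE // qa ev_pmul ev_pconst ev_pconst ev_patom.
  by rewrite mulrC.
have E := weyl_minus_metric oU sb (pE _ i2 i2 q22) (pE _ i1 i2 q12) (pE _ i1 i1 q11) i j k l Ux0.
exact: flat_ev0 (etrans (esym E) (flat sol Ux0 i j k l)).
Qed.

End LocalSolutions.

(** * Necessity of the form of f *)

Section JetCoordinates.
Context {R : realType}.
Local Notation J := (jet1 R).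

Definition jet_x (i : 'I_4) (z : J) : R := z.1.1 ord0 i.

Lemma derive_jet_x i (v z : J) : 'D_v (jet_x i) z = jet_x i v.
Proof.
apply: derive_affine => h; rewrite /jet_x /= !mxE addrC; congr (_ + _).
Qed.

Lemma differentiable_jet_x i (z : J) : differentiable (jet_x i) z.
Proof.
have c1 : continuous (fst : J -> 'rV[R]_4 * R) by move=> [a b]; exact: cvg_fst.
have c2 : continuous (fst : 'rV[R]_4 * R -> 'rV[R]_4) by move=> [a b]; exact: cvg_fst.
apply: (differentiable_comp (f := fst \o fst) (g := fun x : 'rV[R]_4 => x ord0 i)).
  apply: differentiable_comp.
    exact: (linear_differentiable (f := fst) z c1).
  exact: (linear_differentiable (f := fst) _ c2).
exact: differentiable_coord.
Qed.

Lemma jet_x_dir_x i k : jet_x i (dir_x k) = (i == k)%:R :> R.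
Proof. by rewrite /jet_x mxE eqxx. Qed.

Lemma jet_x_dir_u i : jet_x i dir_u = 0 :> R.
Proof. by rewrite /jet_x mxE. Qed.

Lemma jet_x_dir_p i k : jet_x i (dir_p k) = 0 :> R.
Proof. by rewrite /jet_x mxE. Qed.

End JetCoordinates.

Definition coord_poly (k : nat) : dpoly := patom k [::].
Definition psq (p : dpoly) : dpoly := pmul p p.

Definition vanishes_at_center (p : dpoly) : bool :=
  all (fun t => has (fun a => (a.1 < 4)%N && (a.2 == [::])) t.2) p.

(* Unification of directional derivatives along different vectors is slow if
   these are unfolded. *)
Opaque dir_x dir_u dir_p.

Lemma all4P (P : pred nat) : all P [:: 0; 1; 2; 3]%N -> forall k : 'I_4, P k.
Proof. by move=> /and5P[p0 p1 p2 p3 _]; apply: ord4P. Qed.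

Section Necessity.
Context {R : realType}.
Local Notation V := 'rV[R]_4.
Local Notation J := (jet1 R).
Variables (D : set J) (f : J -> R).
Hypotheses (D_open : open D) (D_connected : connected D) (f_smooth : smooth_on D f).
Hypothesis flat : forall U u, solution f D U u -> forall x, U x ->
     forall i j k l, weyl_minus (metric f u) x i j k l = 0.

Lemma ev_vanishes x0 w (c : seq R) p : vanishes_at_center p ->
  ev (coord_base x0 w c) p x0 = 0.
Proof.
elim: p => //= t p IH /andP[ht hp]; rewrite (IH hp) addr0.
suff -> : mono_ev (coord_base x0 w c) t.2 x0 = 0 by rewrite mulr0.
elim: (t.2) ht => //= a m IHm /orP[|hm]; last by rewrite (IHm hm) mulr0.
move=> /andP[ak /eqP a0]; rewrite /atom_ev a0 /multi_partial /=.
case: (a.1) ak => [|[|[|[|]]]] //= _; by rewrite subrr mul0r.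
Qed.

(** What is left of the second total derivative of [f] in x3 when all [u_3k] and [u_33k] vanish. *)
Definition jet_base_term (z : J) : R :=
  'D_(dir_x i3) ('D_(dir_x i3) f) z + z.2 ord0 i3 * 'D_dir_u ('D_(dir_x i3) f) z
  + z.2 ord0 i3 * ('D_(dir_x i3) ('D_dir_u f) z
                   + z.2 ord0 i3 * 'D_dir_u ('D_dir_u f) z).

Definition is_cubic_test (q : dpoly) (n : nat -> nat) : bool :=
  let d := poly_derive in
  is_test_poly q 2 0 0 &&
  all (fun k => vanishes_at_center (d 2 (d k q)) &&
                (d 2 (d 2 (d k q)) == pconst (znat (n k)))) [:: 0; 1; 2; 3]%N.

Lemma partial_jet_row u (x0 : V) v0 p0 i :
  jet u x0 = (x0, v0, p0) -> partial i u x0 = p0 ord0 i.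
Proof. by move=> [_ <-]; rewrite mxE. Qed.

(** For [u_11 = 2], [u_12 = u_22 = 0] the component (1, 4, 3, 4) is a multiple of the second
    x3-derivative of [f] along [u]; the final equation is its expansion by the chain rule. *)
Lemma flat_test33 q x0 v0 p0 : is_test_poly q 2 0 0 -> D (x0, v0, p0) ->
  exists u, [/\ jet u x0 = (x0, v0, p0), partial i3 u x0 = p0 ord0 i3,
    forall k : 'I_4, partial i3 (partial k u) x0
      = ev (coord_base x0 (cst 0) [::]) (poly_derive 2 (poly_derive k q)) x0,
    forall k : 'I_4, partial i3 (partial i3 (partial k u)) x0
      = ev (coord_base x0 (cst 0) [::]) (poly_derive 2 (poly_derive 2 (poly_derive k q))) x0 &
    jet_derive u i3 ('D_(dir_x i3) f) x0 + partial i3 u x0 * jet_derive u i3 ('D_dir_u f) x0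
    + \sum_k partial i3 (partial k u) x0 * jet_derive u i3 ('D_(dir_p k) f) x0
    + partial i3 (partial i3 u) x0 * 'D_dir_u f (jet u x0)
    + \sum_k partial i3 (partial i3 (partial k u)) x0 * 'D_(dir_p k) f (jet u x0) = 0].
Proof.
move=> tq Dz.
have [U [u [sol Ux0 ju dE hf]]] := test_flat D_open f_smooth flat tq Dz.
have [oU su solP] := sol.
have UD x : U x -> D (jet u x) by move=> /solP[].
have sw : smooth_on U (cst 0 : V -> R) by apply: smooth_on_cst.
have wE (j : 'I_4) x : U x -> partial j (cst 0 : V -> R) x
    = ev (coord_base x0 (cst 0) [::]) [::] x by move=> _; apply: derive_cst.
exists u; split=> //.
- exact: partial_jet_row ju.
- by move=> k; rewrite dE.
- move=> k; rewrite (partial_eq_on i3 oU (dE i3 k) Ux0).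
  exact: (@partial_coord R U oU x0 (cst 0) (fun=> [::]) [::] sw wE i3
    (poly_derive i3 (poly_derive k q)) x0 Ux0).
rewrite -(partial2_jet_derive oU su UD i3 f_smooth Ux0).
have := hf i1 i4 i3 i4.
have -> : test_half 2 0 0 i1 i4 i3 i4
    = pscale (znat 6144) (patom 0 [:: 0; 0; 2]%N) by vm_compute.
by rewrite ev_pscale ev_patom zr_nat => /eqP; rewrite mulf_eq0 pnatr_eq0 /= => /eqP.
Qed.

(* [jet_base_term] is the same for all cubic tests, so that they isolate the
   derivatives of [f] with respect to the gradient. *)
Lemma cubic_test q n z : is_cubic_test q n -> D z ->
  jet_base_term z + \sum_(k < 4) (n k)%:R * 'D_(dir_p k) f z = 0.
Proof.
move=> /andP[tq /all4P hq] Dz.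
case: z Dz => [[x0 v0] p0] Dz.
have [u [ju p3 dE d3E]] := flat_test33 tq Dz.
have pu0 (k : 'I_4) : partial i3 (partial k u) x0 = 0.
  by rewrite dE; have /andP[/(ev_vanishes x0 (cst 0) [::])] := hq k.
have pu1 (k : 'I_4) : partial i3 (partial i3 (partial k u)) x0 = (n k)%:R.
  have /andP[_ /eqP E] := hq k.
  rewrite d3E; apply: (etrans (congr1 (fun p => ev (coord_base x0 (cst 0) [::]) p x0) E)).
  by rewrite ev_pconst zr_nat.
rewrite pu0 mul0r addr0.
rewrite [X in _ + X + _]big1 ?addr0; last by move=> k _; rewrite pu0 mul0r.
have S0 G : \sum_k partial i3 (partial k u) x0 * 'D_(dir_p k) G (jet u x0) = 0.
  by rewrite big1 // => k _; rewrite pu0 mul0r.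
have JE G : jet_derive u i3 G x0 = 'D_(dir_x i3) G (x0, v0, p0)
    + p0 ord0 i3 * 'D_dir_u G (x0, v0, p0).
  by rewrite /jet_derive (S0 G) addr0 p3 ju.
move=> E; apply: (etrans _ E); apply: f_equal2.
  apply: f_equal2; first exact: esym (JE _).
  apply: f_equal2; [exact: esym p3 | exact: esym (JE _)].
apply: eq_bigr => k _; apply: f_equal2; first exact: esym (pu1 k).
by rewrite -ju.
Qed.

Lemma jet_base_term0 z : D z -> jet_base_term z = 0.
Proof.
move=> Dz.
have /cubic_test/(_ Dz) : is_cubic_test (psq (coord_poly 0)) (fun=> 0%N) by vm_compute.
by rewrite big1 ?addr0 // => k _; rewrite mul0r.
Qed.

Lemma cubic_test0 q (k : 'I_4) n : is_cubic_test q (fun j => if j == k then n.+1 else 0)%N ->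
  forall z, D z -> 'D_(dir_p k) f z = 0.
Proof.
move=> tq z Dz; have := cubic_test tq Dz; rewrite jet_base_term0 // add0r.
rewrite (bigD1 k) //= eqxx big1 ?addr0 => [|j jk]; last first.
  by rewrite -val_eqE in jk; rewrite (negPf jk) mul0r.
by move=> /eqP; rewrite mulf_eq0 pnatr_eq0 => /eqP.
Qed.

Lemma fiber_derive0 k z : D z -> 'D_(dir_p k) f z = 0.
Proof.
pose y := coord_poly.
move: k z; apply: ord4P.
(* Each test is [y1^2] plus a cubic whose only non-zero [u_33k] is the wanted one. Here
   [- 2 y2 y3 y4] compensates the [u_13 = 2 y3] coming from [y1 y3^2]. *)
- apply: (@cubic_test0 (padd (psq (y 0%N)) (psub (pmul (y 0%N) (psq (y 2)))
    (pscale (znat 2) (pmul (y 1%N) (pmul (y 2) (y 3)))))) i1 1).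
  by vm_compute.
- apply: (@cubic_test0 (padd (psq (y 0%N)) (pmul (y 1%N) (psq (y 2)))) i2 1).
  by vm_compute.
- apply: (@cubic_test0 (padd (psq (y 0%N)) (pmul (y 2) (psq (y 2)))) i3 5).
  by vm_compute.
- apply: (@cubic_test0 (padd (psq (y 0%N)) (pmul (psq (y 2)) (y 3))) i4 1).
  by vm_compute.
Qed.

Lemma derive_zero_on (G : J -> R) w : (forall z, D z -> G z = 0) ->
  forall z, D z -> 'D_w G z = 0.
Proof.
move=> G0 z Dz; rewrite (derive_eq_on w D_open (f := G) (g := cst 0)) //.
exact: derive_cst.
Qed.

Lemma derive_swap (G : J -> R) w w' : smooth_on D G ->
  (forall z, D z -> 'D_w G z = 0) -> forall z, D z -> 'D_w ('D_w' G) z = 0.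
Proof.
move=> sG G0 z Dz; rewrite (derive_comm w w' D_open sG Dz).
exact: derive_zero_on G0 z Dz.
Qed.

(** With the gradient derivatives gone, [y1^2 + y3^2] yields the same equation as [y1^2] except for
    [u_33 = 2], which is the coefficient of ['D_dir_u f]. *)
Lemma value_derive0 z : D z -> 'D_dir_u f z = 0.
Proof.
case: z => [[x0 v0] p0] Dz.
have tq : is_test_poly (padd (psq (coord_poly 0)) (psq (coord_poly 2))) 2 0 0.
  by vm_compute.
have [u [ju p3 dE d3E]] := flat_test33 tq Dz.
have fp0 k w z : D z -> 'D_w ('D_(dir_p k) f) z = 0.
  exact: derive_zero_on (@fiber_derive0 k) z.
have fp0' k w z : D z -> 'D_(dir_p k) ('D_w f) z = 0.
  exact: derive_swap f_smooth (@fiber_derive0 k) z.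
have Du : D (jet u x0) by rewrite ju.
have JE w : jet_derive u i3 ('D_w f) x0 = 'D_(dir_x i3) ('D_w f) (x0, v0, p0)
    + p0 ord0 i3 * 'D_dir_u ('D_w f) (x0, v0, p0).
  rewrite /jet_derive big1 ?addr0 => [|k _]; first by rewrite p3 ju.
  by rewrite (fp0' _ _ _ Du) mulr0.
rewrite [X in _ + X + _ + _]big1 ?addr0; last first.
  move=> k _; rewrite /jet_derive (fp0 _ _ _ Du) (fp0 _ _ _ Du) big1 => [|l _].
    by rewrite !mulr0 !addr0 mulr0.
  by rewrite (fp0 _ _ _ Du) mulr0.
rewrite [X in _ + X = 0]big1 ?addr0; last first.
  by move=> k _; rewrite fiber_derive0 // mulr0.
have -> : partial i3 (partial i3 u) x0 = 2.
  rewrite dE; have -> : poly_derive 2 (poly_derive i3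
    (padd (psq (coord_poly 0)) (psq (coord_poly 2)))) = pconst (znat 2) by vm_compute.
  by rewrite ev_pconst zr_nat.
move=> E; have B := jet_base_term0 Dz.
have {}E : jet_base_term (x0, v0, p0) + 2 * 'D_dir_u f (x0, v0, p0) = 0.
  apply: (etrans _ E); apply: f_equal2; last by rewrite ju.
  apply: f_equal2; first exact: esym (JE _).
  apply: f_equal2; [exact: esym p3 | exact: esym (JE _)].
by move: E; rewrite B add0r => /eqP; rewrite mulf_eq0 pnatr_eq0 => /eqP.
Qed.

Section BaseFunctions.
Variables (U : set V) (u : V -> R).
Hypotheses (oU : open U) (su : smooth_on U u) (UD : forall x, U x -> D (jet u x)).

(** Locally, functions of x alone. Since derivations commute the class is stable under them, and the
    total derivatives of its members along [u] are plain x-derivatives. *)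
Definition basic (G : J -> R) : Prop :=
  [/\ smooth_on D G, forall z, D z -> 'D_dir_u G z = 0 &
      forall k z, D z -> 'D_(dir_p k) G z = 0].

Lemma basic_f : basic f.
Proof. by split=> //; [exact: value_derive0|move=> k z; exact: fiber_derive0]. Qed.

Lemma basic_derive G w : basic G -> basic ('D_w G).
Proof.
move=> [sG u0 p0]; split; first exact: smooth_on_derive.
  exact: derive_swap sG u0.
by move=> k; exact: derive_swap sG (p0 k).
Qed.

Lemma partial_basic G i x : basic G -> U x ->
  partial i (G \o jet u) x = 'D_(dir_x i) G (jet u x).
Proof.
move=> [sG u0 p0] Ux; apply: (etrans (partial_jet_derive su UD i sG Ux)).
rewrite /jet_derive u0; last exact: UD.
by rewrite mulr0 addr0 big1 ?addr0 // => k _; rewrite p0 ?mulr0 //; apply: UD.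
Qed.

Lemma partial2_basic G i j x : basic G -> U x ->
  partial i (partial j (G \o jet u)) x = 'D_(dir_x i) ('D_(dir_x j) G) (jet u x).
Proof.
move=> bG Ux.
rewrite (partial_eq_on i oU (fun y Uy => partial_basic j bG Uy) Ux).
exact: (partial_basic i (basic_derive (dir_x j) bG) Ux).
Qed.

End BaseFunctions.

Notation hess i j z := ('D_(dir_x i) ('D_(dir_x j) f) z).

Lemma basic_test q a11 a12 a22 z : is_test_poly q a11 a12 a22 -> D z ->
  exists F : V -> R,
    [/\ forall i j k l : 'I_4,
         ev (single_base F) (test_half a11 a12 a22 i j k l) z.1.1 = 0 &
        forall i j, partial i (partial j F) z.1.1 = hess i j z].
Proof.
case: z => [[x0 v0] p0] tq Dz.
have [U [u [sol Ux0 ju dE hf]]] := test_flat D_open f_smooth flat tq Dz.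
have [oU su solP] := sol.
have UD x : U x -> D (jet u x) by move=> /solP[].
exists (f \o jet u); split; first exact: hf.
by move=> i j; rewrite (partial2_basic oU su UD i j basic_f Ux0) ju.
Qed.

Lemma single_term0 (F : V -> R) c s p x : p = pscale c (patom 0 s) ->
  ~~ zeqb c z0 -> ev (single_base F) p x = 0 -> multi_partial s F x = 0.
Proof. by move=> pE c0 /(unscale0 pE c0); rewrite ev_patom. Qed.

(** For [u = l^2] with [l] linear in x1, x2, the components used are, up to terms with a factor [f]
    that vanish by the preceding relations, second derivatives of [f] in two directions: 2 and 3 for
    [l = y1], 1 and 4 for [l = y2], d_1 - d_2 and d_3 + d_4 for [l = y1 + y2]. Polarisation then
    gives the mixed relations. *)
Lemma hess_relations z : D z ->
  [/\ [/\ hess i1 i1 z = 0, hess i2 i2 z = 0 & hess i1 i2 z = 0],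
      [/\ hess i3 i3 z = 0, hess i4 i4 z = 0 & hess i3 i4 z = 0] &
      [/\ hess i2 i3 z = 0, hess i1 i4 z = 0 & hess i2 i4 z = hess i1 i3 z]].
Proof.
move=> Dz; pose y := coord_poly.
have t1 : is_test_poly (psq (y 0%N)) 2 0 0 by vm_compute.
have t2 : is_test_poly (psq (y 1%N)) 0 0 2 by vm_compute.
have t3 : is_test_poly (psq (padd (y 0%N) (y 1%N))) 2 2 2 by vm_compute.
have [F1 [f1 h1]] := basic_test t1 Dz.
have [F2 [f2 h2]] := basic_test t2 Dz.
have [F3 [f3 h3]] := basic_test t3 Dz.
pose m n := BinInt.Z.opp (znat n).
have E22 : hess i2 i2 z = 0.
  (* Here and below the integer is the coefficient of the derivative in the computed component. *)
  by rewrite -h1; apply: (@single_term0 F1 (m 1024) [:: 0; 2]%N _ _ _ _ (f1 i1 i1 i1 i3)); vm_compute.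
have E23 : hess i2 i3 z = 0.
  by rewrite -h1; apply: (@single_term0 F1 (znat 3072) [:: 0; 1; 1]%N _ _ _ _ (f1 i1 i4 i2 i4)); vm_compute.
have E33 : hess i3 i3 z = 0.
  by rewrite -h1; apply: (@single_term0 F1 (znat 6144) [:: 0; 0; 2]%N _ _ _ _ (f1 i1 i4 i3 i4)); vm_compute.
have E11 : hess i1 i1 z = 0.
  by rewrite -h2; apply: (@single_term0 F2 (m 1024) [:: 2]%N _ _ _ _ (f2 i1 i1 i1 i3)); vm_compute.
have E14 : hess i1 i4 z = 0.
  by rewrite -h2; apply: (@single_term0 F2 (m 3072) [:: 1; 0; 0; 1]%N _ _ _ _ (f2 i1 i4 i2 i4)); vm_compute.
have E44 : hess i4 i4 z = 0.
  by rewrite -h2; apply: (@single_term0 F2 (znat 6144) [:: 0; 0; 0; 2]%N _ _ _ _ (f2 i1 i4 i3 i4)); vm_compute.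
pose a s := patom 0 s.
pose S3 := single_base F3 0.
have M11 : multi_partial [:: 2]%N S3 z.1.1 = 0 := etrans (h3 i1 i1) E11.
have M22 : multi_partial [:: 0; 2]%N S3 z.1.1 = 0 := etrans (h3 i2 i2) E22.
have M14 : multi_partial [:: 1; 0; 0; 1]%N S3 z.1.1 = 0 := etrans (h3 i1 i4) E14.
have M23 : multi_partial [:: 0; 1; 1]%N S3 z.1.1 = 0 := etrans (h3 i2 i3) E23.
have M33 : multi_partial [:: 0; 0; 2]%N S3 z.1.1 = 0 := etrans (h3 i3 i3) E33.
have M44 : multi_partial [:: 0; 0; 0; 2]%N S3 z.1.1 = 0 := etrans (h3 i4 i4) E44.
have M12 : multi_partial [:: 1; 1]%N S3 z.1.1 = 0.
  have E : test_half 2 2 2 i1 i1 i1 i3 = pscale (m 1024) (padd (a [:: 2]%N)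
    (psub (a [:: 0; 2]%N) (pscale (znat 2) (a [:: 1; 1]%N)))) by vm_compute.
  have := unscale0 E isT (f3 i1 i1 i1 i3).
  rewrite ev_padd ev_psub ev_pscale !ev_patom zr_nat -/S3.
  move: M11 M22; generalize (multi_partial [:: 2]%N S3 z.1.1).
  generalize (multi_partial [:: 0; 2]%N S3 z.1.1) => r r' -> -> /eqP.
  by rewrite !add0r oppr_eq0 mulf_eq0 pnatr_eq0 => /eqP.
have M24 : multi_partial [:: 0; 1; 0; 1]%N S3 z.1.1 = multi_partial [:: 1; 0; 1]%N S3 z.1.1.
  have E : test_half 2 2 2 i1 i4 i2 i4 = pscale (znat 3072) (padd
    (padd (psub (a [:: 0; 1; 0; 1]%N) (a [:: 1; 0; 1]%N)) (psub (a [:: 0; 1; 1]%N) (a [:: 1; 0; 0; 1]%N)))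
    (pscale (znat 2) (pmul (a [::]) (psub (psub (pscale (znat 2) (a [:: 1; 1]%N))
       (a [:: 2]%N)) (a [:: 0; 2]%N))))) by vm_compute.
  have := unscale0 E isT (f3 i1 i4 i2 i4).
  rewrite !(ev_padd, ev_psub, ev_pscale, ev_pmul, ev_patom) !zr_nat -/S3.
  move: M11 M22 M12 M23 M14.
  generalize (multi_partial [:: 2]%N S3 z.1.1) (multi_partial [:: 0; 2]%N S3 z.1.1)
    (multi_partial [:: 1; 1]%N S3 z.1.1) (multi_partial [:: 0; 1; 1]%N S3 z.1.1)
    (multi_partial [:: 1; 0; 0; 1]%N S3 z.1.1) (multi_partial [:: 0; 1; 0; 1]%N S3 z.1.1)
    (multi_partial [:: 1; 0; 1]%N S3 z.1.1) (multi_partial [::] S3 z.1.1).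
  by move=> ? ? ? ? ? r s ? -> -> -> -> -> H; apply/eqP; rewrite -subr_eq0 -H; apply/eqP; ring.
have M34 : multi_partial [:: 0; 0; 1; 1]%N S3 z.1.1 = 0.
  have E : test_half 2 2 2 i1 i4 i3 i4 = pscale (znat 6144) (padd
    (padd (padd (a [:: 0; 0; 2]%N) (a [:: 0; 0; 0; 2]%N)) (pscale (znat 2) (a [:: 0; 0; 1; 1]%N)))
    (pscale (znat 2) (pmul (a [::]) (padd (psub (a [:: 1; 0; 1]%N) (a [:: 0; 1; 0; 1]%N))
     (psub (a [:: 1; 0; 0; 1]%N) (a [:: 0; 1; 1]%N)))))) by vm_compute.
  have := unscale0 E isT (f3 i1 i4 i3 i4).
  rewrite !(ev_padd, ev_psub, ev_pscale, ev_pmul, ev_patom) !zr_nat -/S3.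
  move: M33 M44 M24 M23 M14.
  generalize (multi_partial [:: 0; 0; 2]%N S3 z.1.1) (multi_partial [:: 0; 0; 0; 2]%N S3 z.1.1)
    (multi_partial [:: 0; 0; 1; 1]%N S3 z.1.1) (multi_partial [:: 0; 1; 1]%N S3 z.1.1)
    (multi_partial [:: 1; 0; 0; 1]%N S3 z.1.1) (multi_partial [:: 0; 1; 0; 1]%N S3 z.1.1)
    (multi_partial [:: 1; 0; 1]%N S3 z.1.1) (multi_partial [::] S3 z.1.1).
  move=> ? ? r ? ? ? ? ? -> -> -> -> -> /eqP; rewrite !subrr !addr0 mulr0 mulr0 addr0 add0r.
  by rewrite mulf_eq0 pnatr_eq0 => /eqP.
have E12 := etrans (esym (h3 i1 i2)) M12.
have E34 := etrans (esym (h3 i3 i4)) M34.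
have E24 := etrans (esym (h3 i2 i4)) (etrans M24 (h3 i1 i3)).
exact: And3 (And3 E11 E22 E12) (And3 E33 E44 E34) (And3 E23 E14 E24).
Qed.

End Necessity.

Opaque derive.

(** * Integration of the Hessian relations *)

Section QuadraticForm.
Context {R : realType}.
Local Notation V := 'rV[R]_4.
Local Notation J := (jet1 R).
Variables (D : set J) (f : J -> R).
Hypotheses (D_open : open D) (D_connected : connected D) (f_smooth : smooth_on D f).

(** The difference of [g] and the linear function has zero derivative in each of the nine basis
    directions of the jet space, hence is constant on the connected set [D]. *)
Lemma affine_of_derive (g : J -> R) (l : 'I_4 -> R) :
  (forall z, D z -> differentiable g z) ->
  (forall k z, D z -> 'D_(dir_x k) g z = l k) ->
  (forall z, D z -> 'D_dir_u g z = 0) ->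
  (forall k z, D z -> 'D_(dir_p k) g z = 0) ->
  forall z z', D z -> D z' ->
    g z - \sum_k l k * jet_x k z = g z' - \sum_k l k * jet_x k z'.
Proof.
move=> dg gx gu gp.
pose s z := \sum_k l k * jet_x k z.
have dx k (z : J) : differentiable (fun y => l k * jet_x k y) z.
  exact: (differentiableZ (l k) (differentiable_jet_x k z)).
have ds (z : J) : differentiable s z.
  rewrite (_ : s = \sum_k (fun y => l k * jet_x k y)); last first.
    by apply/funext => y; rewrite fct_sumE.
  by apply: differentiable_sum.
have Ds v (z : J) : 'D_v s z = \sum_k l k * jet_x k v.
  apply: derive_affine => h; rewrite /s big_distrr -big_split /=.
  apply: eq_bigr => k _; rewrite /jet_x /= !mxE; ring.
have dgs z : D z -> differentiable (g - s) z.
  by move=> Dz; apply: differentiableB; [exact: dg|exact: ds].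
have D0 w z : D z -> 'D_w g z = \sum_k l k * jet_x k w -> 'D_w (g - s) z = 0.
  move=> Dz E; have d1 := diff_derivable (v := w) (dg z Dz).
  have d2 := diff_derivable (v := w) (ds z).
  by rewrite (deriveB d1 d2) E Ds subrr.
move=> z z' Dz Dz'.
apply: (derive0_connected_cst D_open D_connected dgs _ Dz Dz') => y v Dy.
have X k : 'D_(dir_x k) (g - s) y = 0.
  apply: (D0 _ _ Dy); rewrite gx // (bigD1 k) //= jet_x_dir_x eqxx mulr1.
  by rewrite big1 ?addr0 // => j jk; rewrite jet_x_dir_x (negPf jk) mulr0.
have W : 'D_dir_u (g - s) y = 0.
  apply: (D0 _ _ Dy); rewrite gu // big1 // => k _; by rewrite jet_x_dir_u mulr0.
have P k : 'D_(dir_p k) (g - s) y = 0.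
  apply: (D0 _ _ Dy); rewrite gp // big1 // => j _; by rewrite jet_x_dir_p mulr0.
apply: (etrans (derive_jet_decomp v (dgs y Dy))).
have zero3 (a b c : R) : a = 0 -> b = 0 -> c = 0 -> a + b + c = 0.
  by move=> -> -> ->; rewrite !addr0.
apply: zero3.
- by apply: big1 => k _; apply: (etrans (congr1 _ (X k))); apply: mulr0.
- by apply: (etrans (congr1 _ W)); apply: mulr0.
- by apply: big1 => k _; apply: (etrans (congr1 _ (P k))); apply: mulr0.
Qed.

Hypothesis flat : forall U u, solution f D U u -> forall x, U x ->
     forall i j k l, weyl_minus (metric f u) x i j k l = 0.

Local Notation fx i := ('D_(dir_x i) f).
Local Notation hess i j := ('D_(dir_x i) ('D_(dir_x j) f)).

Let bf := basic_f D_open f_smooth flat.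
Let bfx i := basic_derive D_open (dir_x i) bf.
Let bh i j := basic_derive D_open (dir_x i) (bfx j).
Let rel := hess_relations D_open f_smooth flat.

Lemma eq_of_sub0 (a b s t : R) : s = 0 -> t = 0 -> a - s = b - t -> a = b.
Proof. by move=> -> ->; rewrite !subr0. Qed.

(** After reordering, [f_13k] for k = 1, 2, 3, 4 is a derivative of [f_11], [f_23], [f_33], [f_34],
    all of which vanish. *)
Lemma hess_cst z z' : D z -> D z' -> hess i1 i3 z = hess i1 i3 z'.
Proof.
move=> Dz Dz'.
have [sh hu hp] := bh i1 i3.
have sx i : smooth_on D (fx i) by apply: smooth_on_derive.
have d0 : forall k z, D z -> 'D_(dir_x k) (hess i1 i3) z = 0.
  apply: ord4P => y Dy.
  - have H t : D t -> hess i1 i3 t = hess i3 i1 t.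
      exact: (derive_comm _ _ D_open f_smooth).
    apply: (etrans (derive_eq_on (dir_x i1) D_open H Dy)).
    apply: (derive_swap D_open (dir_x i3) (sx i1) _ Dy) => t Dt.
    have [[E _ _] _ _] := rel Dt; exact: E.
  - apply: (derive_swap D_open (dir_x i1) (sx i3) _ Dy) => t Dt.
    have [_ _ [E _ _]] := rel Dt; exact: E.
  - apply: (derive_swap D_open (dir_x i1) (sx i3) _ Dy) => t Dt.
    have [_ [E _ _] _] := rel Dt; exact: E.
  - apply: (derive_swap D_open (dir_x i1) (sx i3) _ Dy) => t Dt.
    have [_ [_ _ E] _] := rel Dt; apply: (etrans _ E).
    exact: (derive_comm _ _ D_open f_smooth Dt).
have S0 t : \sum_k 0 * jet_x k t = 0 :> R by rewrite big1 // => k _; rewrite mul0r.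
have := affine_of_derive (smooth_on_diff sh) d0 hu hp Dz Dz'.
exact: eq_of_sub0 (S0 z) (S0 z').
Qed.

(** Two integrations: each [f_i] is affine with slope [c0] in one coordinate, and removing the
    quadratic part from [f] leaves constant first derivatives. *)
Lemma quadratic_form : exists c0 c1 c2 c3 c4 c5 : R,
  forall z, D z -> f z =
    c0 * (jet_x i1 z * jet_x i3 z + jet_x i2 z * jet_x i4 z)
    + c1 * jet_x i1 z + c2 * jet_x i2 z + c3 * jet_x i3 z + c4 * jet_x i4 z + c5.
Proof.
have [[z0 Dz0]|D0] := pselect (exists z, D z); last first.
  by exists 0, 0, 0, 0, 0, 0 => z Dz; case: D0; exists z.
have [c0 hC] : exists c0 : R, forall y, D y -> hess i1 i3 y = c0.
  by exists (hess i1 i3 z0) => y Dy; apply: hess_cst Dy Dz0.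
(* The index paired with [i] by the quadratic form x1 x3 + x2 x4. *)
pose flip (i : 'I_4) : 'I_4 := if i == i1 then i3 else if i == i2 then i4
  else if i == i3 then i1 else i2.
have hE : forall i k y, D y -> 'D_(dir_x k) (fx i) y = (if k == flip i then c0 else 0).
  move=> i k y Dy; have [[h11 h22 h12] [h33 h44 h34] [h23 h14 h24]] := rel Dy.
  have sym a b : hess a b y = hess b a y := derive_comm _ _ D_open f_smooth Dy.
  have h13 := hC y Dy.
  move: i k; apply: ord4P; apply: ord4P.
  - exact: h11.
  - exact: etrans (sym i2 i1) h12.
  - exact: etrans (sym i3 i1) h13.
  - exact: etrans (sym i4 i1) h14.
  - exact: h12.
  - exact: h22.
  - exact: etrans (sym i3 i2) h23.
  - exact: etrans (sym i4 i2) (etrans h24 h13).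
  - exact: h13.
  - exact: h23.
  - exact: h33.
  - exact: etrans (sym i4 i3) h34.
  - exact: h14.
  - exact: etrans h24 h13.
  - exact: h34.
  - exact: h44.
pose c i := fx i z0 - c0 * jet_x (flip i) z0.
have fxE i y : D y -> fx i y = c0 * jet_x (flip i) y + c i.
  move=> Dy; have [sx xu xp] := bfx i.
  have := affine_of_derive (smooth_on_diff sx) (hE i) xu xp Dy Dz0.
  have S t : \sum_k (if k == flip i then c0 else 0) * jet_x k t = c0 * jet_x (flip i) t.
    rewrite (bigD1 (flip i)) //= eqxx big1 ?addr0 // => j jf.
    by rewrite (negPf jf) mul0r.
  by rewrite !S -/(c i) => <-; rewrite addrC subrK.
pose q (z : J) := c0 * (jet_x i1 z * jet_x i3 z + jet_x i2 z * jet_x i4 z).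
have dX i (z : J) := differentiable_jet_x i z.
have dq (z : J) : differentiable q z.
  apply: (differentiableZ c0); apply: differentiableD; exact: differentiableM.
have Dq v (z : J) : 'D_v q z = c0 * (jet_x i1 z * jet_x i3 v + jet_x i3 z * jet_x i1 v
     + (jet_x i2 z * jet_x i4 v + jet_x i4 z * jet_x i2 v)).
  have dv i : derivable (jet_x i) z v by apply: diff_derivable.
  have dm i j : derivable (jet_x i * jet_x j) z v by apply: derivableM.
  rewrite -!(derive_jet_x _ v z).
  apply: (etrans (deriveMl c0 (derivableD (dm i1 i3) (dm i2 i4)))); congr (_ * _).
  rewrite (deriveD (dm i1 i3) (dm i2 i4)).
  by rewrite (deriveM (dv i1) (dv i3)) (deriveM (dv i2) (dv i4)).
have [_ fu fp] := bf.
have dfq z : D z -> differentiable (f - q) z.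
  by move=> Dz; apply: differentiableB; [exact: smooth_on_diff f_smooth _ Dz|exact: dq].
have Dfq w z : D z -> 'D_w (f - q) z = 'D_w f z - 'D_w q z.
  move=> Dz; apply: deriveB; apply: diff_derivable => //.
  exact: smooth_on_diff f_smooth _ Dz.
have e1 : forall k z, D z -> 'D_(dir_x k) (f - q) z = c k.
  move=> k z Dz; rewrite (Dfq _ _ Dz) (fxE _ _ Dz) Dq !jet_x_dir_x.
  by move: k; apply: ord4P; rewrite /flip /=; ring.
have e2 z : D z -> 'D_dir_u (f - q) z = 0.
  by move=> Dz; rewrite (Dfq _ _ Dz) (fu _ Dz) Dq !jet_x_dir_u; ring.
have e3 k z : D z -> 'D_(dir_p k) (f - q) z = 0.
  by move=> Dz; rewrite (Dfq _ _ Dz) (fp _ _ Dz) Dq !jet_x_dir_p; ring.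
exists c0, (c i1), (c i2), (c i3), (c i4), ((f - q) z0 - \sum_k c k * jet_x k z0).
move=> z Dz; have := affine_of_derive dfq e1 e2 e3 Dz Dz0.
move=> <-; rewrite big_ord4 /q !fctE; ring.
Qed.

End QuadraticForm.

(** * Reduction along solutions *)

(* Base functions: 0 is [f] along the solution, 1 is the solution. *)
Definition fu_poly (s : seq nat) : dpoly := pmul (patom 0 [::]) (patom 1 s).

Definition fu_half :=
  walker_half (fu_poly [:: 0; 2]%N) (fu_poly [:: 1; 1]%N) (fu_poly [:: 2]%N).

Definition fu_det : dpoly :=
  psub (pmul (patom 1 [:: 2]%N) (patom 1 [:: 0; 2]%N))
       (pmul (patom 1 [:: 1; 1]%N) (patom 1 [:: 1; 1]%N)).

Definition pde_rhs : dpoly :=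
  psub (psub [::] (patom 1 [:: 0; 1; 0; 1]%N)) (pmul (patom 0 [::]) fu_det).

Definition derive_rules (rs : seq (atom * dpoly)) : seq (atom * dpoly) :=
  flatten [seq [seq (incr i r.1, pderive i r.2) | r <- rs] | i <- [:: 0; 1; 2; 3]%N].

(* The equation solved for u_13, and its first and second derivatives. *)
Definition pde_rules0 : seq (atom * dpoly) := [:: ((1%N, [:: 1; 0; 1]%N), pde_rhs)].
Definition pde_rules : seq (atom * dpoly) :=
  pde_rules0 ++ (derive_rules pde_rules0 ++ derive_rules (derive_rules pde_rules0)).

Definition form_rules : seq (atom * dpoly) :=
  ((0%N, [:: 0; 1; 0; 1]%N), patom 0 [:: 1; 0; 1]%N) ::
  [seq ((0%N, s), [::]) | s <- [:: [:: 2]; [:: 1; 1]; [:: 0; 2]; [:: 0; 0; 2];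
     [:: 0; 0; 1; 1]; [:: 0; 0; 0; 2]; [:: 0; 1; 1]; [:: 1; 0; 0; 1]]%N].

(** Right-hand sides may be reducible again: [u_1133] leads to [u_1234], and this to [f_24], which
    is replaced by [f_13]. Hence three passes. *)
Definition reduce (p : dpoly) : dpoly :=
  iter 3 (psubst (apply_rules (form_rules ++ pde_rules))) p.

Definition obstruction : dpoly :=
  psub (pmul (patom 0 [::]) (patom 0 [:: 1; 0; 1]%N))
    (padd (pmul (patom 0 [:: 1]%N) (patom 0 [:: 0; 0; 1]%N))
          (pmul (patom 0 [:: 0; 1]%N) (patom 0 [:: 0; 0; 0; 1]%N))).

Definition obstruction_term : dpoly := pscale (znat 6144) (pmul obstruction fu_det).

Definition fu_table : seq (seq (seq (seq dpoly))) :=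
  let A := fu_poly [:: 0; 2]%N in let B := fu_poly [:: 1; 1]%N in
  let C := fu_poly [:: 2]%N in weyl_table (walker_G2 A B C) (walker_GI A B C).

Definition reduces (r : dpoly) : bool :=
  [|| r == [::], psub r obstruction_term == [::] | padd r obstruction_term == [::]].

(* [T] is an argument, so that the table is evaluated only once. *)
Definition all_reduce (T : seq (seq (seq (seq dpoly)))) : bool :=
  let GI := walker_GI (fu_poly [:: 0; 2]%N) (fu_poly [:: 1; 1]%N) (fu_poly [:: 2]%N) in
  let r := [:: 0; 1; 2; 3]%N in
  all (fun i => all (fun j => all (fun k => all (fun l =>
    reduces (reduce (half_poly GI T false i j k l))) r) r) r) r.

(** The cast leaves the evaluation of all 256 components to the kernel at [Qed], so that it is run
    once. *)
Lemma all_reduce_fu : all_reduce fu_table.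
Proof. by vm_cast_no_check (erefl true). Qed.

Lemma reduce_half (i j k l : 'I_4) : reduces (reduce (fu_half false i j k l)).
Proof.
have := all_reduce_fu.
by move=> /all4P/(_ i)/all4P/(_ j)/all4P/(_ k)/all4P/(_ l).
Qed.

(** For necessity one component is required that does reduce to the obstruction, with a non-zero
    factor; membership in [reduces] would also admit zero. *)
Lemma reduce_1434 : psub (reduce (fu_half false 0 3 2 3)) obstruction_term = [::].
Proof. by vm_cast_no_check (erefl ([::] : dpoly)). Qed.

Section AlongSolutions.
Context {R : realType}.
Local Notation V := 'rV[R]_4.
Variables (U : set V) (F u : V -> R).
Hypotheses (oU : open U) (sF : smooth_on U F) (su : smooth_on U u).

Definition fu_base (k : nat) : V -> R :=
  match k with 0 => F | 1 => u | _ => cst 0 end.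

Lemma smooth_on_fu_base k : smooth_on U (fu_base k).
Proof. by case: k => [|[|k]] //=; apply: smooth_on_cst. Qed.

Definition form_like : Prop := forall s, s \in [:: [:: 2]; [:: 1; 1]; [:: 0; 2];
  [:: 0; 0; 2]; [:: 0; 0; 1; 1]; [:: 0; 0; 0; 2]; [:: 0; 1; 1]; [:: 1; 0; 0; 1]]%N ->
  forall x, U x -> multi_partial s F x = 0.

Hypothesis F0 : form_like.
Hypothesis F24 : forall x, U x ->
  multi_partial [:: 0; 1; 0; 1]%N F x = multi_partial [:: 1; 0; 1]%N F x.
Hypothesis pde : forall x, U x ->
  partial i1 (partial i3 u) x + partial i2 (partial i4 u) x
  + F x * (partial i1 (partial i1 u) x * partial i2 (partial i2 u) x
           - partial i1 (partial i2 u) x ^+ 2) = 0.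

Definition sound (rs : seq (atom * dpoly)) : Prop :=
  forall r, r \in rs -> forall x, U x -> atom_ev fu_base r.1 x = ev fu_base r.2 x.

Lemma cat_sound rs rs' : sound rs -> sound rs' -> sound (rs ++ rs').
Proof. by move=> h h' r; rewrite mem_cat => /orP[/h|/h']. Qed.

Lemma derive_rules_sound rs : sound rs -> sound (derive_rules rs).
Proof.
move=> h r /flattenP[s /mapP[i i4 ->] /mapP[r' r'rs ->]] x Ux /=.
have i_lt : (i < 4)%N by move: i4; rewrite !inE => /or4P[] /eqP ->.
exact: (@derive_rule R U fu_base (Ordinal i_lt) r'.1 r'.2 oU smooth_on_fu_base (h _ r'rs) x Ux).
Qed.

Lemma form_rules_sound : sound form_rules.
Proof.
move=> r; rewrite in_cons => /orP[/eqP -> x Ux|/mapP[s sP ->] x Ux].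
  by rewrite ev_patom; apply: F24.
exact: F0.
Qed.

Lemma pde_rules0_sound : sound pde_rules0.
Proof.
move=> t; rewrite inE => /eqP -> x Ux.
rewrite !(ev_psub, ev_pmul, ev_patom) ev_nil.
have E (a b c d e g : R) : a + b + c * (d * e - g ^+ 2) = 0 ->
   a = 0 - b - c * (d * e - g * g).
  move=> H; transitivity ((a + b + c * (d * e - g ^+ 2)) - b - c * (d * e - g * g)).
    ring.
  by rewrite H.
exact: E (pde Ux).
Qed.

Lemma rules_sound : sound (form_rules ++ pde_rules).
Proof.
apply: (cat_sound form_rules_sound); apply: (cat_sound pde_rules0_sound).
have s1 := derive_rules_sound pde_rules0_sound.
exact: cat_sound s1 (derive_rules_sound s1).
Qed.

Lemma ev_reduce p x : U x -> ev fu_base (reduce p) x = ev fu_base p x.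
Proof.
move=> Ux.
have E q : ev fu_base (psubst (apply_rules (form_rules ++ pde_rules)) q) x
    = ev fu_base q x.
  by apply: ev_psubst_rules => r rP; apply: rules_sound rP _ Ux.
by rewrite /reduce /iter !E.
Qed.

Definition obstruction_value (x : V) : R :=
  F x * partial i1 (partial i3 F) x
  - (partial i1 F x * partial i3 F x + partial i2 F x * partial i4 F x).

Lemma ev_obstruction x : ev fu_base obstruction x = obstruction_value x.
Proof. by rewrite !(ev_psub, ev_padd, ev_pmul, ev_patom). Qed.

Lemma half_eq0 x (i j k l : 'I_4) : U x -> obstruction_value x = 0 ->
  ev fu_base (fu_half false i j k l) x = 0.
Proof.
move=> Ux K0; rewrite -ev_reduce //.
have T0 : ev fu_base obstruction_term x = 0.
  by rewrite ev_pscale ev_pmul ev_obstruction K0 mul0r mulr0.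
have /or3P[/eqP -> //|/eqP/ev_eq_of_psub -> //|/eqP E] := reduce_half i j k l.
by have := ev_padd fu_base (reduce (fu_half false i j k l)) obstruction_term x;
  rewrite E T0 addr0 => <-.
Qed.

Lemma obstruction_eq0 x : U x -> ev fu_base (fu_half false 0 3 2 3) x = 0 ->
  partial i1 (partial i1 u) x * partial i2 (partial i2 u) x
    - partial i1 (partial i2 u) x ^+ 2 != 0 ->
  obstruction_value x = 0.
Proof.
move=> Ux H0 d0.
have H := etrans (esym (ev_eq_of_psub fu_base x reduce_1434)) (etrans (ev_reduce _ Ux) H0).
have := unscale0 (erefl obstruction_term) isT H.
rewrite ev_pmul ev_obstruction => /eqP; rewrite mulf_eq0 => /orP[/eqP //|].
rewrite !(ev_psub, ev_pmul, ev_patom) => /eqP E; case/eqP: d0.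
by rewrite expr2; apply: E.
Qed.

End AlongSolutions.

(* The constants c_0, ..., c_5 are the base functions 5, ..., 10. *)
Definition form_poly : dpoly :=
  let y k := patom k [::] in
  padd (pmul (y 5) (padd (pmul (y 0) (y 2)) (pmul (y 1) (y 3))))
  (padd (pmul (y 6) (y 0)) (padd (pmul (y 7) (y 1)) (padd (pmul (y 8) (y 2))
  (padd (pmul (y 9) (y 3)) (y 10)))))%N.

(** * The quadratic function along a solution *)

Section FormAlongSolution.
Context {R : realType}.
Local Notation V := 'rV[R]_4.
Variables (U : set V) (F : V -> R) (c0 c1 c2 c3 c4 c5 : R).
Hypothesis oU : open U.
Hypothesis FE : forall x, U x ->
  F x = c0 * (x ord0 i1 * x ord0 i3 + x ord0 i2 * x ord0 i4)
        + c1 * x ord0 i1 + c2 * x ord0 i2 + c3 * x ord0 i3 + c4 * x ord0 i4 + c5.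

Let cb := coord_base (0 : V) (cst 0) [:: c0; c1; c2; c3; c4; c5].
Let sw : smooth_on U (cst 0 : V -> R) := @smooth_on_cst R V U 0.
Let wE (j : 'I_4) x : U x -> partial j (cst 0 : V -> R) x = ev cb ((fun=> [::]) (j : nat)) x.
Proof. by move=> _; apply: derive_cst. Qed.

Lemma form_ev x : U x -> ev cb form_poly x = F x.
Proof.
move=> Ux; rewrite FE // /form_poly !(ev_padd, ev_pmul, ev_patom).
rewrite /multi_partial /= !mxE /cst; ring.
Qed.

Lemma smooth_on_form : smooth_on U F.
Proof.
apply: (smooth_on_eq oU form_ev).
exact: (smooth_on_ev oU (smooth_on_coord_base 0 [:: c0; c1; c2; c3; c4; c5] sw) form_poly).
Qed.

Lemma partial_form (i : 'I_4) x : U x ->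
  partial i F x = ev cb (poly_derive i form_poly) x.
Proof.
move=> Ux; apply: (etrans (esym (partial_eq_on i oU form_ev Ux))).
exact: (@partial_coord R U oU 0 (cst 0) (fun=> [::]) _ sw wE i form_poly x Ux).
Qed.

Lemma partial2_form (i j : 'I_4) x : U x ->
  partial i (partial j F) x = ev cb (poly_derive i (poly_derive j form_poly)) x.
Proof.
move=> Ux; apply: (etrans (partial_eq_on i oU (partial_form j) Ux)).
exact: (@partial_coord R U oU 0 (cst 0) (fun=> [::]) _ sw wE i _ x Ux).
Qed.

Lemma partial2_form0 (i j : 'I_4) x : U x ->
  poly_derive i (poly_derive j form_poly) = [::] -> partial i (partial j F) x = 0.
Proof. by move=> Ux E; rewrite partial2_form // E. Qed.

Lemma form_like_form : form_like U F.
Proof.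
move=> s; rewrite !inE; do 7?case/orP; move=> /eqP -> x Ux.
- by apply: (@partial2_form0 i1 i1) Ux _; vm_compute.
- by apply: (@partial2_form0 i1 i2) Ux _; vm_compute.
- by apply: (@partial2_form0 i2 i2) Ux _; vm_compute.
- by apply: (@partial2_form0 i3 i3) Ux _; vm_compute.
- by apply: (@partial2_form0 i3 i4) Ux _; vm_compute.
- by apply: (@partial2_form0 i4 i4) Ux _; vm_compute.
- by apply: (@partial2_form0 i2 i3) Ux _; vm_compute.
- by apply: (@partial2_form0 i1 i4) Ux _; vm_compute.
Qed.

Lemma form_13_24 x : U x ->
  multi_partial [:: 0; 1; 0; 1]%N F x = multi_partial [:: 1; 0; 1]%N F x.
Proof.
move=> Ux; apply: (etrans (@partial2_form i2 i4 x Ux)).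
apply: (etrans _ (esym (@partial2_form i1 i3 x Ux))).
by congr (ev cb _ x); vm_compute.
Qed.

(** Completing the square: [c0 F] is [(c0 x3 + c1) (c0 x1 + c3) + (c0 x4 + c2) (c0 x2 + c4)] plus
    the constant on the right, and the four brackets are the first derivatives of [F]. *)
Lemma obstruction_form x : U x ->
  obstruction_value F x = c0 * c5 - c1 * c3 - c2 * c4.
Proof.
move=> Ux; rewrite /obstruction_value partial2_form // !partial_form // FE //.
pose y k := patom k [::].
rewrite (_ : poly_derive i1 (poly_derive i3 form_poly) = y 5); last by vm_compute.
rewrite (_ : poly_derive i1 form_poly = padd (pmul (y 2) (y 5)) (y 6)); last by vm_compute.
rewrite (_ : poly_derive i2 form_poly = padd (pmul (y 3) (y 5)) (y 7)); last by vm_compute.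
rewrite (_ : poly_derive i3 form_poly = padd (pmul (y 0) (y 5)) (y 8)); last by vm_compute.
rewrite (_ : poly_derive i4 form_poly = padd (pmul (y 1) (y 5)) (y 9)); last by vm_compute.
rewrite !(ev_padd, ev_pmul, ev_patom) /multi_partial /= !mxE /cst; ring.
Qed.

End FormAlongSolution.

(** * The two halves of the Weyl tensor on solutions *)

Section WeylOnSolutions.
Context {R : realType}.
Local Notation V := 'rV[R]_4.
Local Notation J := (jet1 R).
Variables (D : set J) (f : J -> R).

Lemma weyl_half_fu (U : set V) u : open U -> smooth_on U u ->
  smooth_on U (f \o jet u) -> forall x (i j k l : 'I_4), U x ->
  weyl_minus (metric f u) x i j k l
    = 3072^-1 * ev (fu_base (f \o jet u) u) (fu_half false i j k l) x /\
  weyl_plus (metric f u) x i j k l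
    = 3072^-1 * ev (fu_base (f \o jet u) u) (fu_half true i j k l) x.
Proof.
move=> oU su sF x i j k l Ux.
have E s x' : f (jet u x') * multi_partial s u x' =
    ev (fu_base (f \o jet u) u) (fu_poly s) x'.
  by rewrite ev_pmul !ev_patom.
have sb := smooth_on_fu_base sF su.
split.
  exact: (weyl_minus_metric oU sb (fun x' _ => E [:: 0; 2]%N x')
    (fun x' _ => E [:: 1; 1]%N x') (fun x' _ => E [:: 2]%N x') i j k l Ux).
exact: (weyl_plus_metric oU sb (fun x' _ => E [:: 0; 2]%N x')
    (fun x' _ => E [:: 1; 1]%N x') (fun x' _ => E [:: 2]%N x') i j k l Ux).
Qed.

Lemma half_flat_of_form (c0 c1 c2 c3 c4 c5 : R) :
  c1 * c3 + c2 * c4 - c0 * c5 = 0 ->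
  (forall (x : V) (v : R) (p : V), D (x, v, p) ->
      f (x, v, p) =
        c0 * (x ord0 i1 * x ord0 i3 + x ord0 i2 * x ord0 i4)
        + c1 * x ord0 i1 + c2 * x ord0 i2 + c3 * x ord0 i3 + c4 * x ord0 i4
        + c5) ->
  forall U u, solution f D U u -> forall x, U x ->
     forall i j k l, weyl_minus (metric f u) x i j k l = 0.
Proof.
move=> K0 fE U u [oU su solP] x Ux i j k l.
have FE y : U y -> (f \o jet u) y =
    c0 * (y ord0 i1 * y ord0 i3 + y ord0 i2 * y ord0 i4)
    + c1 * y ord0 i1 + c2 * y ord0 i2 + c3 * y ord0 i3 + c4 * y ord0 i4 + c5.
  by move=> /solP[Dy _]; apply: fE.
have sF := smooth_on_form oU FE.
have [-> _] := weyl_half_fu oU su sF i j k l Ux.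
rewrite (half_eq0 oU sF su (form_like_form oU FE) (form_13_24 oU FE)) ?mulr0 //.
  by move=> y /solP[].
rewrite (obstruction_form oU FE) //.
by apply/eqP; rewrite -oppr_eq0 -K0; apply/eqP; ring.
Qed.

Hypotheses (D_open : open D) (f_smooth : smooth_on D f).

(** The component (2, 1, 1, 4) is a multiple of the second x1-derivative of [f u_11]. For the
    quartic only [f u_1111 = 24 f] survives at the centre. *)
Lemma zero_of_plus_flat :
  (forall U u, solution f D U u -> forall x, U x ->
     forall i j k l, weyl_plus (metric f u) x i j k l = 0) ->
  forall z, D z -> f z = 0.
Proof.
move=> flat [[x0 v0] p0] Dz.
pose q := psq (psq (coord_poly 0)).
have dq : is_developable q by vm_compute.
have [U [u [sol Ux0 ju dE]]] := developable_solution f D_open dq Dz.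
have [oU su solP] := sol.
have sF : smooth_on U (f \o jet u).
  by apply: (smooth_on_comp_jet oU su f_smooth) => x /solP[].
have [_ E] := weyl_half_fu oU su sF i2 i1 i1 i4 Ux0.
have H := flat_ev0 (etrans (esym E) (flat _ _ sol _ Ux0 i2 i1 i1 i4)).
pose a := patom 0; pose b := patom 1.
have P : fu_half true i2 i1 i1 i4 = pscale (BinInt.Z.opp (znat 3072))
   (padd (pmul (a [::]) (b [:: 4]%N)) (padd (pscale (znat 2) (pmul (a [:: 1]%N) (b [:: 3]%N)))
      (pmul (a [:: 2]%N) (b [:: 2]%N)))) by vm_compute.
have := unscale0 P isT H.
rewrite !(ev_padd, ev_pscale, ev_pmul, ev_patom).
pose cb := coord_base x0 (cst 0) ([::] : seq R).
have sw : smooth_on U (cst 0 : V -> R) := @smooth_on_cst R V U 0.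
have wE (j : 'I_4) x : U x -> partial j (cst 0 : V -> R) x = ev cb ((fun=> [::]) (j : nat)) x.
  by move=> _; apply: derive_cst.
have e2 x : U x -> partial i1 (partial i1 u) x
   = ev cb (poly_derive 0 (poly_derive 0 q)) x by apply: dE.
have e3 x : U x -> partial i1 (partial i1 (partial i1 u)) x
   = ev cb (poly_derive 0 (poly_derive 0 (poly_derive 0 q))) x.
  move=> Ux; apply: (etrans (partial_eq_on i1 oU e2 Ux)).
  exact: (@partial_coord R U oU x0 (cst 0) (fun=> [::]) _ sw wE i1 _ x Ux).
have e4 x : U x -> partial i1 (partial i1 (partial i1 (partial i1 u))) x
   = ev cb (poly_derive 0 (poly_derive 0 (poly_derive 0 (poly_derive 0 q)))) x.
  move=> Ux; apply: (etrans (partial_eq_on i1 oU e3 Ux)).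
  exact: (@partial_coord R U oU x0 (cst 0) (fun=> [::]) _ sw wE i1 _ x Ux).
have m2 : multi_partial [:: 2]%N (fu_base (f \o jet u) u 1) x0 = 0.
  by apply: (etrans (e2 _ Ux0)); apply: ev_vanishes; vm_compute.
have m3 : multi_partial [:: 3]%N (fu_base (f \o jet u) u 1) x0 = 0.
  by apply: (etrans (e3 _ Ux0)); apply: ev_vanishes; vm_compute.
have m4 : multi_partial [:: 4]%N (fu_base (f \o jet u) u 1) x0 = 24.
  apply: (etrans (e4 _ Ux0)).
  rewrite (_ : poly_derive 0 _ = pconst (znat 24)); last by vm_compute.
  by rewrite ev_pconst zr_nat.
move: m2 m3 m4; generalize (multi_partial [:: 2]%N (fu_base (f \o jet u) u 1) x0)
  (multi_partial [:: 3]%N (fu_base (f \o jet u) u 1) x0)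
  (multi_partial [:: 4]%N (fu_base (f \o jet u) u 1) x0) => r s t -> -> ->.
rewrite !mulr0 !addr0 => /eqP; rewrite mulf_eq0 pnatr_eq0 orbF => /eqP.
by rewrite -ju.
Qed.

End WeylOnSolutions.

(** * The quadratic constraint *)

(* Base functions: 0-3 are the centred coordinates y1, ..., y4, 4 is w = 1/M,
   5-10 are c0, ..., c5, and 11-15 are kappa, alpha, beta, mu, nu, where
   M = c0 (y3^2 + y4^2) + 2 c1 y3 + 2 c2 y4 + kappa.  The solution is
   (y1^2 + y2^2) w + y1 (alpha + mu y3 + nu y4) w + y2 (beta - nu y3 + mu y4) w. *)
Definition denom_poly : dpoly :=
  let y k := patom k [::] in
  padd (pmul (y 5) (padd (psq (y 2)) (psq (y 3))))
  (padd (pscale (znat 2) (padd (pmul (y 6) (y 2)) (pmul (y 7) (y 3)))) (y 11))%N.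

Definition denom_derive (i : nat) : dpoly :=
  let y k := patom k [::] in
  match i with
  | 2 => pscale (znat 2) (padd (pmul (y 5) (y 2)) (y 6))
  | 3 => pscale (znat 2) (padd (pmul (y 5) (y 3)) (y 7))
  | _ => [::]
  end%N.

Definition inv_denom_derive (i : nat) : dpoly :=
  psub [::] (pmul (denom_derive i) (psq (patom 4 [::]))).

Definition rational_derive := cderive (coord_dt inv_denom_derive).

(** Let [u = (y1^2 + y2^2) w + y1 A + y2 B] with [w], [A], [B] functions of y3, y4. The part of the
    equation linear in y1, y2 reads [d_3 (1/w) = 2 (c0 y3 + c1)] and [d_4 (1/w) = 2 (c0 y4 + c2)],
    which is the origin of M. The factor [w] in [A] and [B] makes the remaining part [w^2] times a
    polynomial in y3, y4; the [nu] terms are a rotation and add nothing quadratic, and the quadratic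
    [mu] terms cancel against [mu M]. *)
Definition rational_poly : dpoly :=
  let y k := patom k [::] in
  pmul (y 4) (padd (padd (psq (y 0)) (psq (y 1)))
   (padd (pmul (y 0) (padd (y 12) (padd (pmul (y 14) (y 2)) (pmul (y 15) (y 3)))))
         (pmul (y 1) (padd (y 13) (psub (pmul (y 14) (y 3)) (pmul (y 15) (y 2)))))))%N.

Definition rational_pde : dpoly :=
  let d := rational_derive in let q := rational_poly in
  padd (padd (d 0 (d 2 q)) (d 1 (d 3 q)))
    (pmul form_poly (psub (pmul (d 0 (d 0 q)) (d 1 (d 1 q))) (psq (d 0 (d 1 q)))))%N.

(** The computation treats [w] as an independent unknown, so the defect of [M w = 1] stays as the
    first summand. [l1], [l2], [l3] are the coefficients of y3, y4 and 1 in the remaining part; the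
    parameters must annihilate them. *)
Definition rational_residue : dpoly :=
  let y k := patom k [::] in
  let l1 := padd (pscale (znat 2) (y 8))
    (psub (padd (pmul (y 14) (y 6)) (pmul (y 15) (y 7))) (pmul (y 12) (y 5))) in
  let l2 := padd (pscale (znat 2) (y 9))
    (psub (psub (pmul (y 14) (y 7)) (pmul (y 15) (y 6))) (pmul (y 13) (y 5))) in
  let l3 := padd (pscale (znat 2) (y 10))
    (psub (psub (pmul (y 14) (y 11)) (pmul (y 12) (y 6))) (pmul (y 13) (y 7))) in
  padd (pmul (pscale (znat 2) (pmul (y 14) (y 4)))
             (psub (pconst (znat 1)) (pmul denom_poly (y 4))))
    (pmul (pscale (znat 2) (psq (y 4)))
          (padd (padd (pmul (y 2) l1) (pmul (y 3) l2)) l3))%N.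

Lemma rational_pdeE : psub rational_pde rational_residue = [::].
Proof. by vm_compute. Qed.

Section Constraint.
Context {R : realType}.
Local Notation V := 'rV[R]_4.
Local Notation J := (jet1 R).

(** M has to exist before [w = 1/M], so it is evaluated with a placeholder in slot 4; its polynomial
    avoids that slot, and so do its derivatives. *)
Lemma ev_coord_base_eq (x0 x : V) (w w' : V -> R) (cs : seq R) p :
  all (fun t => all (fun a => a.1 != 4%N) t.2) p ->
  ev (coord_base x0 w cs) p x = ev (coord_base x0 w' cs) p x.
Proof.
elim: p => //= t p IH /andP[ht hp]; rewrite (IH hp); congr (_ * _ + _).
elim: (t.2) ht => //= a m IHm /andP[ha hm]; rewrite (IHm hm); congr (_ * _).
by case: a ha => [[|[|[|[|[|k]]]]] s].
Qed.

Lemma det_neq0 (t p q r : R) :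
  t != 0 -> p = 2 * t -> q = 2 * t -> r = 0 -> p * q - r ^+ 2 != 0.
Proof.
by move=> t0 -> -> ->; rewrite expr0n subr0 !mulf_neq0 ?pnatr_eq0.
Qed.

Lemma ev_pde (bs : nat -> V -> R) p q r s t v x :
  ev bs (padd (padd p q) (pmul r (psub (pmul s t) (psq v)))) x
  = ev bs p x + ev bs q x + ev bs r x * (ev bs s x * ev bs t x - ev bs v x ^+ 2).
Proof. by rewrite !ev_padd ev_pmul ev_psub !ev_pmul expr2. Qed.

(* Solvability of the linear system for the parameters of the rational
   solution. *)
Lemma rational_parameters (c0 c1 c2 c3 c4 c5 : R) :
  ~ [/\ c0 = 0, c1 = 0 & c2 = 0] ->
  exists k a b m n : R, [/\ k != 0, 2 * c3 + (m * c1 + n * c2 - a * c0) = 0,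
    2 * c4 + (m * c2 - n * c1 - b * c0) = 0 &
    2 * c5 + (m * k - a * c1 - b * c2) = 0].
Proof.
move=> nz; pose d := c1 ^+ 2 + c2 ^+ 2.
have d_ge0 : 0 <= d by rewrite addr_ge0 ?sqr_ge0.
have [c00|c0n] := eqVneq c0 0.
  have dn : d != 0.
    apply/eqP => /eqP; rewrite paddr_eq0 ?sqr_ge0 // !sqrf_eq0 => /andP[/eqP h1 /eqP h2].
    by apply: nz; split.
  (* [m], [n] solve the first two equations, a linear system of determinant [- d]; then [(a, b)] is
     taken along [(c1, c2)] to satisfy the third. *)
  pose m := - 2 * (c1 * c3 + c2 * c4) / d.
  pose n := - 2 * (c2 * c3 - c1 * c4) / d.
  exists 1, ((m + 2 * c5) * c1 / d), ((m + 2 * c5) * c2 / d), m, n.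
  by rewrite c00; move: dn; rewrite /m /n /d => dn; split;
    [exact: oner_neq0|field; exact: dn..].
(* With [n = 0] the first two equations determine [a] and [b]. The third becomes
   [m (c0 k - d) = 2 (c1 c3 + c2 c4 - c0 c5)], and this [k] makes [c0 k - d] equal to 1. *)
pose k := (d + 1) / c0.
pose m := 2 * (c1 * c3 + c2 * c4) - 2 * c0 * c5.
exists k, ((m * c1 + 2 * c3) / c0), ((m * c2 + 2 * c4) / c0), m, 0; split.
- by rewrite mulf_neq0 ?invr_eq0 // gt_eqF // ltr_wpDl.
- by field.
- by field.
- by rewrite /k /m /d; field.
Qed.

Variables (D : set J) (f : J -> R).
Hypotheses (D_open : open D) (f_smooth : smooth_on D f).
Hypothesis flat : forall U u, solution f D U u -> forall x, U x ->
     forall i j k l, weyl_minus (metric f u) x i j k l = 0.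
Variables (c0 c1 c2 c3 c4 c5 : R).
Hypothesis fE : forall (x : V) (v : R) (p : V), D (x, v, p) ->
      f (x, v, p) =
        c0 * (x ord0 i1 * x ord0 i3 + x ord0 i2 * x ord0 i4)
        + c1 * x ord0 i1 + c2 * x ord0 i2 + c3 * x ord0 i3 + c4 * x ord0 i4
        + c5.

Lemma constraint_of_flat z : D z -> c1 * c3 + c2 * c4 - c0 * c5 = 0.
Proof.
case: z => [[x0 v0] p0] Dz.
(* In coordinates centred at [x0] the form of [f] keeps [c0], while its first derivatives and value
   at [x0] replace [c1], ..., [c5]. *)
pose e1 := c1 + c0 * x0 ord0 i3; pose e2 := c2 + c0 * x0 ord0 i4.
pose e3 := c3 + c0 * x0 ord0 i1; pose e4 := c4 + c0 * x0 ord0 i2.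
pose e5 := f (x0, v0, p0).
(* In the first case [c1] and [c2] vanish as well and the constraint is trivial; otherwise the
   parameters of the rational solution exist. *)
have [[c00 e10 e20]|nz] := pselect [/\ c0 = 0, e1 = 0 & e2 = 0].
  move: e10 e20; rewrite /e1 /e2 c00 !mul0r !addr0 => -> ->; ring.
have [k [a [b [m [n [k0 L1 L2 L3]]]]]] := rational_parameters e3 e4 e5 nz.
pose cs := [:: c0; e1; e2; e3; e4; e5; k; a; b; m; n].
pose M := ev (coord_base x0 (cst 0) cs) denom_poly.
pose w x := (M x)^-1.
pose bs := coord_base x0 w cs.
pose U0 := [set x | M x != 0].
have oT : open (@setT V) by apply: openT.
have s0 : smooth_on setT (cst 0 : V -> R) by apply: smooth_on_cst.
have sM : smooth_on setT M.
  exact: (smooth_on_ev oT (smooth_on_coord_base x0 cs s0) denom_poly).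
have oU0 : open U0.
  rewrite openE => x Mx.
  have cM := differentiable_continuous (smooth_on_diff sM (I : setT x)).
  exact: (cM _ (open_nbhs_nbhs (conj (@open_neq _ 0) Mx))).
have sM0 : smooth_on U0 M by apply: smooth_on_sub sM.
have sw : smooth_on U0 w by apply: smooth_onV.
have wE (j : 'I_4) x : U0 x -> partial j w x = ev bs (inv_denom_derive j) x.
  move=> Ux.
  have dM := smooth_on_derivable (v := delta_mx ord0 j) sM0 Ux.
  have z0E (i : 'I_4) y : setT y -> partial i (cst 0 : V -> R) y
      = ev (coord_base x0 (cst 0) cs) ((fun=> [::]) (i : nat)) y.
    by move=> _; apply: derive_cst.
  have EM := @partial_coord R setT oT x0 (cst 0) (fun=> [::]) cs s0 z0E j denom_poly x I.
  apply: (etrans (deriveV Ux dM)).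
  rewrite -[X in _ *: X]/(partial j M x) EM ev_psub ev_pmul ev_pmul ev_patom sub0r.
  have ED : cderive (coord_dt (fun=> [::])) j denom_poly = denom_derive j.
    by elim/ord4P: j {EM dM}; vm_compute.
  have EB : ev (coord_base x0 (cst 0) cs) (denom_derive j) x = ev bs (denom_derive j) x.
    by apply: ev_coord_base_eq; elim/ord4P: j {EM dM ED}.
  rewrite ED EB.
  rewrite -[X in _ *: X]/(ev bs (denom_derive j) x) -[LHS]/(_ * _).
  by rewrite mulNr mulrC /w -expr2 exprVn.
have sb := smooth_on_coord_base x0 cs sw.
have Ux0 : U0 x0.
  rewrite /U0 /= /M /denom_poly !(ev_padd, ev_pmul, ev_pscale, ev_patom).
  by rewrite /multi_partial /= !subrr !(mulr0, mul0r, add0r).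
have [u [su ju uE]] := prescribe_jet v0 p0 oU0 (smooth_on_ev oU0 sb rational_poly) Ux0.
have dE (i j : 'I_4) x : U0 x -> partial i (partial j u) x
    = ev bs (rational_derive i (rational_derive j rational_poly)) x.
  by move=> Ux; rewrite (uE i j x Ux); apply: (partial2_coord oU0 sw wE i j rational_poly Ux).
have fform x : D (jet u x) -> f (jet u x) = ev bs form_poly x.
  move=> Dx; rewrite /jet (fE Dx) /form_poly !(ev_padd, ev_pmul, ev_patom).
  rewrite /multi_partial /= /e5 (fE Dz) /e4 /e3 /e2 /e1 /cst; ring.
have residue0 x : U0 x -> ev bs rational_residue x = 0.
  move=> Ux; have Mw : ev bs denom_poly x * w x = 1.
    have -> : ev bs denom_poly x = M x by apply: ev_coord_base_eq.
    exact: mulfV.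
  have -> : ev bs rational_residue x
      = 2 * m * w x * (1 - ev bs denom_poly x * w x) + 2 * w x ^+ 2 *
        ((x ord0 i3 - x0 ord0 i3) * (2 * e3 + (m * e1 + n * e2 - a * c0))
         + (x ord0 i4 - x0 ord0 i4) * (2 * e4 + (m * e2 - n * e1 - b * c0))
         + (2 * e5 + (m * k - a * e1 - b * e2))).
    rewrite /rational_residue /denom_poly.
    rewrite !(ev_padd, ev_psub, ev_pmul, ev_pscale, ev_pconst, ev_patom) !zr_nat.
    rewrite /multi_partial /= /cst; ring.
  by rewrite Mw L1 L2 L3 subrr !(mulr0, addr0).
have sol : solution f D (U0 `&` jet u @^-1` D) u.
  apply: (solution_restrict D_open oU0 su) => x Ux Dx.
  rewrite /pde_lhs /partial2 !dE // fform //.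
  apply: (etrans (esym (ev_pde _ _ _ _ _ _ _ _))).
  apply: (etrans (ev_eq_of_psub bs x rational_pdeE)).
  exact: residue0.
have [oU sU _] := sol; set U := U0 `&` _ in sol oU sU.
have UD x : U x -> D (jet u x) by move=> [].
have Ux : U x0 by split=> //=; rewrite ju.
have FE y : U y -> (f \o jet u) y =
    c0 * (y ord0 i1 * y ord0 i3 + y ord0 i2 * y ord0 i4)
    + c1 * y ord0 i1 + c2 * y ord0 i2 + c3 * y ord0 i3 + c4 * y ord0 i4 + c5.
  by move=> /UD; apply: fE.
have sF := smooth_on_form oU FE.
have pde y : U y -> partial i1 (partial i3 u) y + partial i2 (partial i4 u) y
  + (f \o jet u) y * (partial i1 (partial i1 u) y * partial i2 (partial i2 u) y
           - partial i1 (partial i2 u) y ^+ 2) = 0.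
  by move=> Uy; have [_ _ /(_ y Uy)[_]] := sol.
have [E _] := weyl_half_fu oU sU sF i1 i4 i3 i4 Ux.
have H := flat_ev0 (etrans (esym E) (flat sol Ux i1 i4 i3 i4)).
have det0 : partial i1 (partial i1 u) x0 * partial i2 (partial i2 u) x0
    - partial i1 (partial i2 u) x0 ^+ 2 != 0.
  have ww (i : 'I_4) : rational_derive i (rational_derive i rational_poly)
      = pscale (znat 2) (patom 4 [::]) -> partial i (partial i u) x0 = 2 * w x0.
    move=> E'; apply: (etrans (dE i i x0 Ux0)).
    by rewrite E' ev_pscale ev_patom zr_nat.
  have w11 : partial i1 (partial i1 u) x0 = 2 * w x0 by apply: ww; vm_compute.
  have w22 : partial i2 (partial i2 u) x0 = 2 * w x0 by apply: ww; vm_compute.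
  have w12 : partial i1 (partial i2 u) x0 = 0.
    apply: (etrans (dE i1 i2 x0 Ux0)).
    by have -> : rational_derive i1 (rational_derive i2 rational_poly) = [::] by vm_compute.
  exact: det_neq0 (invr_neq0 Ux0) w11 w22 w12.
have := obstruction_eq0 oU sF sU (form_like_form oU FE) (form_13_24 oU FE) pde Ux H det0.
rewrite (obstruction_form oU FE Ux) => K0.
by apply/eqP; rewrite -oppr_eq0 -K0; apply/eqP; ring.
Qed.

End Constraint.

Theorem mainTheorem5 (R : realType) (D : set (jet1 R)) (f : jet1 R -> R)
    (D_open : open D) (D_connected : connected D) (f_smooth : smooth_on D f) :
  half_flat_on_every_solution f D <->
  exists c0 c1 c2 c3 c4 c5 : R,
    c1 * c3 + c2 * c4 - c0 * c5 = 0 /\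
    forall (x : 'rV[R]_4) (v : R) (p : 'rV[R]_4), D (x, v, p) ->
      f (x, v, p) =
        c0 * (x ord0 i1 * x ord0 i3 + x ord0 i2 * x ord0 i4)
        + c1 * x ord0 i1 + c2 * x ord0 i2 + c3 * x ord0 i3 + c4 * x ord0 i4
        + c5.
Proof.
split=> [[flat|flat]|].
- have [c0 [c1 [c2 [c3 [c4 [c5 fE]]]]]] := quadratic_form D_open D_connected f_smooth flat.
  have fE' (x : 'rV[R]_4) (v : R) (p : 'rV[R]_4) : D (x, v, p) -> _ := fE (x, v, p).
  (* The constraint is read off from a solution through a point of [D]; for empty [D] the zero
     constants are taken. *)
  have [[z Dz]|D0] := pselect (exists z, D z).
    exists c0, c1, c2, c3, c4, c5; split=> //.
    exact: (constraint_of_flat D_open flat fE' Dz).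
  exists 0, 0, 0, 0, 0, 0; split; first by rewrite !mul0r !addr0 subrr.
  by move=> x v p Dx; case: D0; exists (x, v, p).
(* Vanishing of the self-dual half forces [f = 0] on [D], which is the required form with zero
   constants. *)
- exists 0, 0, 0, 0, 0, 0; split; first by rewrite !mul0r !addr0 subrr.
  move=> x v p Dx; rewrite (zero_of_plus_flat D_open f_smooth flat Dx).
  by rewrite !mul0r !addr0.
move=> [c0 [c1 [c2 [c3 [c4 [c5 [K0 fE]]]]]]]; left.
exact: half_flat_of_form K0 fE.
Qed.
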